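(* Let $\mathbf k$ be a field of characteristic zero and $w$ a weight function on $\mathbf k$. Let $\mathbf C^w_*(\mathbf k)$ be the category of pairs $(P,f)$, where $P$ is a finite type complex of $\mathbf k$-vector spaces and $f$ is an endomorphism of $P$ which is pure of weight $0$. Then $\mathbf C^w_*(\mathbf k)$ is a formal symmetric monoidal category, i.e. its identity functor is weakly equivalent to the homology functor $H:\mathbf C^w_*(\mathbf k)\to\mathbf C^w_*(\mathbf k)$ in the category of symmetric monoidal functors.
   Context: Complexes have differential of degree $-1$; the tensor product of complexes carries the Koszul sign in the commutativity isomorphism. A complex $P$ is of finite type if each $P_i$ is finite dimensional; likewise $HP$ is of finite type if $H_iP$ is finite dimensional for all $i$. A weight function on $\mathbf k$ is a group morphism $w:\Gamma\to\mathbb Z$ defined on a subgroup $\Gamma$ of the multiplicative group $\overline{\mathbf k}^*$ of an algebraic closure $\overline{\mathbf k}$ of $\mathbf k$. An element $\lambda\in\overline{\mathbf k}$ is pure of weight $n$ if $\lambda\in\Gamma$ and $w(\lambda)=n$; a polynomial in $\mathbf k[t]$ is pure of weight $n$ if all its roots in $\overline{\mathbf k}$ are pure of weight $n$; an endomorphism of a finite dimensional $\mathbf k$-vector space is pure of weight $n$ if its characteristic polynomial is pure of weight $n$. If $P$ is a complex with $HP$ of finite type, an endomorphism $f$ of $P$ is pure of weight $n$ if $H_i(f)$ is pure of weight $n+i$ for all $i$. Morphisms $(P,f)\to(Q,g)$ in $\mathbf C^w_*(\mathbf k)$ are chain maps commuting with the endomorphisms; the tensor product is $(P\otimes Q,f\otimes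 g)$ and the unit is $\mathbf k$ with the identity. The homology functor is $H(P,f)=(HP,Hf)$, with the usual Künneth morphism. A symmetric monoidal functor is a functor $F$ with natural morphisms $\kappa_{X,Y}:FX\otimes FY\to F(X\otimes Y)$ and a morphism $\eta:\mathbf 1\to F\mathbf 1$ compatible with the associativity, commutativity and unit constraints; a natural transformation is monoidal if it is compatible with $\kappa$ and $\eta$. Two symmetric monoidal functors are weakly equivalent if they are connected by a finite zigzag of monoidal natural transformations of symmetric monoidal functors, each of which is a homology isomorphism on every object.
   Formalization: The complexes P in the category are additionally required to be bounded below, because the tensor product of unbounded finite type complexes need not be of finite type, so the category as stated is not closed under tensor product. *)

(* Defs.v *)
From HB Require Import structures.
From mathcomp Require Import all_boot all_order all_algebra.
From mathcomp Require Import boolp.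
From Stdlib Require Import Relation_Operators.

Set Implicit Arguments.
Unset Strict Implicit.
Unset Printing Implicit Defensive.
Set Warnings "-redundant-canonical-projection".

Import Order.TTheory GRing.Theory Num.Theory.

Local Open Scope ring_scope.
Local Open Scope quotient_scope.

Record category := Category {
  ob :> Type;
  hom : ob -> ob -> Type;
  idm : forall X, hom X X;
  comp : forall X Y Z, hom Y Z -> hom X Y -> hom X Z;
  comp1m : forall X Y (f : hom X Y), comp (idm Y) f = f;
  compm1 : forall X Y (f : hom X Y), comp f (idm X) = f;
  compA : forall X Y Z T (h : hom Z T) (g : hom Y Z) (f : hom X Y),
    comp h (comp g f) = comp (comp h g) f
}.
Arguments hom {c} X Y.
Arguments idm {c} X.
Arguments comp {c X Y Z} g f.

Notation "g \oc f" := (comp g f) (at level 50, left associativity).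

Record smcat := SMCat {
  smc_cat :> category;
  ten : smc_cat -> smc_cat -> smc_cat;
  tenm : forall X X' Y Y' : smc_cat,
    hom X X' -> hom Y Y' -> hom (ten X Y) (ten X' Y');
  unit_ob : smc_cat;
  assoc : forall X Y Z, hom (ten (ten X Y) Z) (ten X (ten Y Z));
  assocV : forall X Y Z, hom (ten X (ten Y Z)) (ten (ten X Y) Z);
  lunit : forall X, hom (ten unit_ob X) X;
  lunitV : forall X, hom X (ten unit_ob X);
  runit : forall X, hom (ten X unit_ob) X;
  runitV : forall X, hom X (ten X unit_ob);
  braid : forall X Y, hom (ten X Y) (ten Y X);
  tenm1 : forall X Y, tenm (idm X) (idm Y) = idm (ten X Y);
  tenm_comp : forall X X' X'' Y Y' Y'' (f' : hom X' X'') (f : hom X X')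
      (g' : hom Y' Y'') (g : hom Y Y'),
    tenm (f' \oc f) (g' \oc g) = tenm f' g' \oc tenm f g;
  assoc_nat : forall X X' Y Y' Z Z' (f : hom X X') (g : hom Y Y')
      (h : hom Z Z'),
    assoc X' Y' Z' \oc tenm (tenm f g) h
    = tenm f (tenm g h) \oc assoc X Y Z;
  lunit_nat : forall X X' (f : hom X X'),
    lunit X' \oc tenm (idm unit_ob) f = f \oc lunit X;
  runit_nat : forall X X' (f : hom X X'),
    runit X' \oc tenm f (idm unit_ob) = f \oc runit X;
  braid_nat : forall X X' Y Y' (f : hom X X') (g : hom Y Y'),
    braid X' Y' \oc tenm f g = tenm g f \oc braid X Y;
  assocK : forall X Y Z, assocV X Y Z \oc assoc X Y Z = idm _;
  assocVK : forall X Y Z, assoc X Y Z \oc assocV X Y Z = idm _;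
  lunitK : forall X, lunitV X \oc lunit X = idm _;
  lunitVK : forall X, lunit X \oc lunitV X = idm _;
  runitK : forall X, runitV X \oc runit X = idm _;
  runitVK : forall X, runit X \oc runitV X = idm _;
  braidK : forall X Y, braid Y X \oc braid X Y = idm _;
  pentagon : forall X Y Z T,
    assoc X Y (ten Z T) \oc assoc (ten X Y) Z T
    = tenm (idm X) (assoc Y Z T) \oc assoc X (ten Y Z) T
      \oc tenm (assoc X Y Z) (idm T);
  triangle : forall X Y,
    tenm (idm X) (lunit Y) \oc assoc X unit_ob Y = tenm (runit X) (idm Y);
  hexagon : forall X Y Z,
    assoc Y Z X \oc braid X (ten Y Z) \oc assoc X Y Z
    = tenm (idm Y) (braid X Z) \oc assoc Y X Z \oc tenm (braid X Y) (idm Z)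
}.
Arguments ten {s} X Y.
Arguments tenm {s X X' Y Y'} f g.
Arguments unit_ob {s}.
Arguments assoc {s} X Y Z.
Arguments assocV {s} X Y Z.
Arguments lunit {s} X.
Arguments lunitV {s} X.
Arguments runit {s} X.
Arguments runitV {s} X.
Arguments braid {s} X Y.

Record functor (C D : category) := Functor {
  fob :> C -> D;
  fmap : forall X Y, hom X Y -> hom (fob X) (fob Y);
  fmap1 : forall X, fmap (idm X) = idm (fob X);
  fmap_comp : forall X Y Z (g : hom Y Z) (f : hom X Y),
    fmap (g \oc f) = fmap g \oc fmap f
}.
Arguments fmap {C D} _ {X Y} _.

(* The structure morphisms kappa and eta are not required to be invertible. *)
Record smfunctor (C D : smcat) := SMFunctor {
  smf_functor :> functor C D;
  kappa : forall X Y,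
    hom (ten (smf_functor X) (smf_functor Y)) (smf_functor (ten X Y));
  eta : hom unit_ob (smf_functor unit_ob);
  kappa_nat : forall X X' Y Y' (f : hom X X') (g : hom Y Y'),
    kappa X' Y' \oc tenm (fmap smf_functor f) (fmap smf_functor g)
    = fmap smf_functor (tenm f g) \oc kappa X Y;
  kappa_assoc : forall X Y Z,
    fmap smf_functor (assoc X Y Z) \oc kappa (ten X Y) Z
      \oc tenm (kappa X Y) (idm (smf_functor Z))
    = kappa X (ten Y Z) \oc tenm (idm (smf_functor X)) (kappa Y Z)
      \oc assoc (smf_functor X) (smf_functor Y) (smf_functor Z);
  kappa_lunit : forall X,
    fmap smf_functor (lunit X) \oc kappa unit_ob X
      \oc tenm eta (idm (smf_functor X))
    = lunit (smf_functor X);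
  kappa_runit : forall X,
    fmap smf_functor (runit X) \oc kappa X unit_ob
      \oc tenm (idm (smf_functor X)) eta
    = runit (smf_functor X);
  kappa_braid : forall X Y,
    fmap smf_functor (braid X Y) \oc kappa X Y
    = kappa Y X \oc braid (smf_functor X) (smf_functor Y)
}.
Arguments kappa {C D} s X Y.
Arguments eta {C D} s.

Record smtrans (C D : smcat) (F G : smfunctor C D) := SMTrans {
  smt :> forall X, hom (F X) (G X);
  smt_nat : forall X Y (f : hom X Y),
    smt Y \oc fmap F f = fmap G f \oc smt X;
  smt_kappa : forall X Y,
    smt (ten X Y) \oc kappa F X Y = kappa G X Y \oc tenm (smt X) (smt Y);
  smt_eta : smt unit_ob \oc eta F = eta G
}.

(* Connected by a finite zigzag of monoidal transformations with components in
   the class [W] of morphisms. *)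
Definition weakly_equivalent (C D : smcat)
    (W : forall X Y : D, hom X Y -> Prop) : smfunctor C D -> smfunctor C D -> Prop :=
  clos_refl_sym_trans (smfunctor C D)
    (fun F G => exists phi : smtrans F G, forall X, W _ _ (phi X)).

Section Identity.
Variable C : smcat.

Definition id_functor : functor C C.
Proof. by refine (@Functor C C id (fun _ _ f => f) _ _). Defined.

Definition id_smfunctor : smfunctor C C.
Proof.
refine (@SMFunctor C C id_functor (fun X Y => idm _) (idm _) _ _ _ _ _) => /=.
- by move=> *; rewrite comp1m compm1.
- by move=> *; rewrite !tenm1 !compm1 comp1m.
- by move=> *; rewrite tenm1 !compm1.
- by move=> *; rewrite tenm1 !compm1.
- by move=> *; rewrite comp1m compm1.
Defined.
End Identity.

Definition formal (C : smcat) (W : forall X Y : C, hom X Y -> Prop)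
    (H : smfunctor C C) : Prop := weakly_equivalent W (id_smfunctor C) H.

Section Endo.
Variable C : smcat.

Record endo_ob := EndoOb { eob : C; emap : hom eob eob }.

Record endo_hom (X Y : endo_ob) := EndoHom {
  ehom :> hom (eob X) (eob Y);
  ehomE : ehom \oc emap X = emap Y \oc ehom
}.

Lemma endo_hom_eq X Y (f g : endo_hom X Y) : ehom f = ehom g -> f = g.
Proof.
by case: f g => [f hf] [g hg] /= e; subst g; rewrite (Prop_irrelevance hf hg).
Qed.

Definition endo_cat : category.
Proof.
unshelve refine (@Category endo_ob endo_hom
  (fun X => @EndoHom X X (idm _) _)
  (fun X Y Z g f => @EndoHom X Z (g \oc f) _) _ _ _).
- by rewrite comp1m compm1.
- by rewrite -compA ehomE !compA ehomE.
- by move=> *; apply: endo_hom_eq; exact: comp1m.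
- by move=> *; apply: endo_hom_eq; exact: compm1.
- by move=> *; apply: endo_hom_eq; exact: compA.
Defined.

Definition endo_ten (X Y : endo_cat) : endo_cat :=
  EndoOb (tenm (emap X) (emap Y)).

Lemma endo_inv (A B : C) (f : hom A B) (g : hom B A) (a : hom A A)
    (b : hom B B) : f \oc g = idm _ -> g \oc f = idm _ ->
  f \oc a = b \oc f -> g \oc b = a \oc g.
Proof.
move=> fg gf h.
by rewrite -[b]compm1 -fg [b \oc _]compA -h !compA gf comp1m.
Qed.

Definition endo_smcat : smcat.
Proof.
unshelve refine (@SMCat endo_cat endo_ten
  (fun X X' Y Y' f g => @EndoHom (endo_ten X Y) (endo_ten X' Y') (tenm f g) _)
  (EndoOb (idm unit_ob))
  (fun X Y Z => @EndoHom (endo_ten (endo_ten X Y) Z)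
     (endo_ten X (endo_ten Y Z)) (assoc _ _ _) _)
  (fun X Y Z => @EndoHom (endo_ten X (endo_ten Y Z))
     (endo_ten (endo_ten X Y) Z) (assocV _ _ _) _)
  (fun X => @EndoHom (endo_ten (EndoOb (idm unit_ob)) X) X (lunit _) _)
  (fun X => @EndoHom X (endo_ten (EndoOb (idm unit_ob)) X) (lunitV _) _)
  (fun X => @EndoHom (endo_ten X (EndoOb (idm unit_ob))) X (runit _) _)
  (fun X => @EndoHom X (endo_ten X (EndoOb (idm unit_ob))) (runitV _) _)
  (fun X Y => @EndoHom (endo_ten X Y) (endo_ten Y X) (braid _ _) _)
  _ _ _ _ _ _ _ _ _ _ _ _ _ _ _ _).
- by rewrite /= -!tenm_comp !ehomE.
- exact: assoc_nat.
- exact: (endo_inv (assocVK _ _ _) (assocK _ _ _) (assoc_nat _ _ _)).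
- exact: lunit_nat.
- exact: (endo_inv (lunitVK _) (lunitK _) (lunit_nat _)).
- exact: runit_nat.
- exact: (endo_inv (runitVK _) (runitK _) (runit_nat _)).
- exact: braid_nat.
- by move=> *; apply: endo_hom_eq; exact: tenm1.
- by move=> *; apply: endo_hom_eq; exact: tenm_comp.
- by move=> *; apply: endo_hom_eq; exact: assoc_nat.
- by move=> *; apply: endo_hom_eq; exact: lunit_nat.
- by move=> *; apply: endo_hom_eq; exact: runit_nat.
- by move=> *; apply: endo_hom_eq; exact: braid_nat.
- by move=> *; apply: endo_hom_eq; exact: assocK.
- by move=> *; apply: endo_hom_eq; exact: assocVK.
- by move=> *; apply: endo_hom_eq; exact: lunitK.
- by move=> *; apply: endo_hom_eq; exact: lunitVK.
- by move=> *; apply: endo_hom_eq; exact: runitK.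
- by move=> *; apply: endo_hom_eq; exact: runitVK.
- by move=> *; apply: endo_hom_eq; exact: braidK.
- by move=> *; apply: endo_hom_eq; exact: pentagon.
- by move=> *; apply: endo_hom_eq; exact: triangle.
- by move=> *; apply: endo_hom_eq; exact: hexagon.
Defined.
End Endo.

Section EndoFunctor.
Variables (C D : smcat) (F : smfunctor C D).

Definition endo_functor : functor (endo_smcat C) (endo_smcat D).
Proof.
unshelve refine (@Functor (endo_smcat C) (endo_smcat D)
  (fun X => EndoOb (fmap F (emap X)))
  (fun X Y f => @EndoHom D (EndoOb (fmap F (emap X)))
     (EndoOb (fmap F (emap Y))) (fmap F (ehom f)) _) _ _).
- by rewrite /= -!fmap_comp ehomE.
- by move=> *; apply: endo_hom_eq; exact: fmap1.
- by move=> *; apply: endo_hom_eq; exact: fmap_comp.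
Defined.

Definition endo_smfunctor : smfunctor (endo_smcat C) (endo_smcat D).
Proof.
unshelve refine (@SMFunctor (endo_smcat C) (endo_smcat D) endo_functor
  (fun X Y => @EndoHom D (endo_ten (endo_functor X) (endo_functor Y))
     (endo_functor (endo_ten X Y)) (kappa F _ _) _)
  (@EndoHom D (EndoOb (idm unit_ob)) (endo_functor (EndoOb (idm unit_ob)))
     (eta F) _) _ _ _ _ _).
- exact: kappa_nat.
- by rewrite /= fmap1 compm1 comp1m.
- by move=> *; apply: endo_hom_eq; exact: kappa_nat.
- by move=> *; apply: endo_hom_eq; exact: kappa_assoc.
- by move=> *; apply: endo_hom_eq; exact: kappa_lunit.
- by move=> *; apply: endo_hom_eq; exact: kappa_runit.
- by move=> *; apply: endo_hom_eq; exact: kappa_braid.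
Defined.
End EndoFunctor.

Section FullSubcategory.
Variables (C : smcat) (S : C -> Prop).

Definition monoidal_closed : Prop :=
  S unit_ob /\ forall X Y, S X -> S Y -> S (ten X Y).

Definition full_cat : category.
Proof.
refine (@Category {X : C | S X} (fun X Y => hom (sval X) (sval Y))
  (fun X => idm _) (fun X Y Z g f => g \oc f) _ _ _).
- by move=> *; exact: comp1m.
- by move=> *; exact: compm1.
- by move=> *; exact: compA.
Defined.

Variable cl : monoidal_closed.

Definition full_smcat : smcat.
Proof.
refine (@SMCat full_cat
  (fun X Y => exist S (ten (sval X) (sval Y)) (cl.2 _ _ (svalP X) (svalP Y)))
  (fun X X' Y Y' f g => tenm f g)
  (exist S unit_ob cl.1)
  (fun X Y Z => assoc _ _ _) (fun X Y Z => assocV _ _ _)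
  (fun X => lunit _) (fun X => lunitV _)
  (fun X => runit _) (fun X => runitV _)
  (fun X Y => braid _ _)
  _ _ _ _ _ _ _ _ _ _ _ _ _ _ _ _).
- by move=> *; exact: tenm1.
- by move=> *; exact: tenm_comp.
- by move=> *; exact: assoc_nat.
- by move=> *; exact: lunit_nat.
- by move=> *; exact: runit_nat.
- by move=> *; exact: braid_nat.
- by move=> *; exact: assocK.
- by move=> *; exact: assocVK.
- by move=> *; exact: lunitK.
- by move=> *; exact: lunitVK.
- by move=> *; exact: runitK.
- by move=> *; exact: runitVK.
- by move=> *; exact: braidK.
- by move=> *; exact: pentagon.
- by move=> *; exact: triangle.
- by move=> *; exact: hexagon.
Defined.

Variables (F : smfunctor C C) (FS : forall X, S X -> S (F X)).

Definition full_functor : functor full_smcat full_smcat.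
Proof.
refine (@Functor full_smcat full_smcat
  (fun X => exist S (F (sval X)) (FS (svalP X)))
  (fun X Y f => fmap F f) _ _).
- by move=> *; exact: fmap1.
- by move=> *; exact: fmap_comp.
Defined.

Definition full_smfunctor : smfunctor full_smcat full_smcat.
Proof.
refine (@SMFunctor full_smcat full_smcat full_functor
  (fun X Y => kappa F _ _) (eta F) _ _ _ _ _).
- by move=> *; exact: kappa_nat.
- by move=> *; exact: kappa_assoc.
- by move=> *; exact: kappa_lunit.
- by move=> *; exact: kappa_runit.
- by move=> *; exact: kappa_braid.
Defined.
End FullSubcategory.

Section GradedTensor.
Variables (k : fieldType) (P Q : int -> lmodType k) (n : int).

(* A family of bilinear maps P_i x Q_j -> V, one for each i + j = n. *)
Record bifam (V : lmodType k) := Bifam {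
  bf :> forall i j, i + j = n -> P i -> Q j -> V;
  bf_linearl : forall i j (e : i + j = n) y, linear (fun x => bf e x y);
  bf_linearr : forall i j (e : i + j = n) x, linear (bf e x)
}.

(* The degree n part of the tensor product, i.e. the direct sum of the
   P_i (x) Q_j over i + j = n, consists of the formal sums of symbols
   x (x) y with x in P_i, y in Q_j and i + j = n, two such sums being
   identified when no family of bilinear maps tells them apart. *)
Definition gen :=
  {ij : {ij : int * int | ij.1 + ij.2 == n}
      & (P (sval ij).1 * Q (sval ij).2)%type}.

Definition fsum_eval V (b : bifam V) (s : seq gen) : V :=
  \sum_(g <- s) b _ _ (eqP (svalP (tag g))) (tagged g).1 (tagged g).2.

Definition fsum_eqv : rel (seq gen) := fun s t =>
  `[< forall V (b : bifam V), fsum_eval b s = fsum_eval b t >].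

Lemma fsum_eqv_refl : reflexive fsum_eqv.
Proof. by move=> s; apply/asboolP. Qed.

Lemma fsum_eqv_sym : symmetric fsum_eqv.
Proof. by move=> s t; apply/asboolP/asboolP => h V b; rewrite h. Qed.

Lemma fsum_eqv_trans : transitive fsum_eqv.
Proof.
by move=> s t u /asboolP h /asboolP h'; apply/asboolP=> V b; rewrite h h'.
Qed.

Canonical fsum_equiv :=
  EquivRel fsum_eqv fsum_eqv_refl fsum_eqv_sym fsum_eqv_trans.

Definition gtens := {eq_quot fsum_eqv}.
HB.instance Definition _ := Choice.on gtens.
HB.instance Definition _ := EqQuotient.on gtens.

Definition tlift V (b : bifam V) (t : gtens) : V := fsum_eval b (repr t).

Lemma tlift_pi V (b : bifam V) s : tlift b (\pi_gtens s) = fsum_eval b s.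
Proof. by rewrite /tlift; case: piP => t /eqmodP/asboolP ->. Qed.

Lemma gtens_sep (t u : gtens) :
  (forall V (b : bifam V), tlift b t = tlift b u) -> t = u.
Proof.
move=> h; rewrite -[t]reprK -[u]reprK; apply/eqmodP/asboolP => V b.
by rewrite -!tlift_pi !reprK.
Qed.

Definition scale_gen a (g : gen) : gen :=
  existT (fun ij => (P (sval ij).1 * Q (sval ij).2)%type)
    (tag g) (a *: (tagged g).1, (tagged g).2).

Definition gtens0 : gtens := \pi_gtens ([::] : seq gen).
Definition gtens_add (t u : gtens) : gtens := \pi_gtens (repr t ++ repr u).
Definition gtens_scale a (t : gtens) : gtens :=
  \pi_gtens (map (scale_gen a) (repr t)).

Lemma bfZl V (b : bifam V) i j (e : i + j = n) a x y :
  b _ _ e (a *: x) y = a *: b _ _ e x y.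
Proof. exact: (scalable_linear (bf_linearl b e y)). Qed.

Lemma bfBl V (b : bifam V) i j (e : i + j = n) x x' y :
  b _ _ e (x - x') y = b _ _ e x y - b _ _ e x' y.
Proof. exact: (zmod_morphism_linear (bf_linearl b e y)). Qed.

Let lift0 V (b : bifam V) : tlift b gtens0 = 0.
Proof. by rewrite tlift_pi /fsum_eval big_nil. Qed.

Let liftD V (b : bifam V) t u : tlift b (gtens_add t u) = tlift b t + tlift b u.
Proof. by rewrite tlift_pi /fsum_eval big_cat. Qed.

Let liftZ V (b : bifam V) a t : tlift b (gtens_scale a t) = a *: tlift b t.
Proof.
rewrite tlift_pi /fsum_eval big_map scaler_sumr.
by apply: eq_bigr => g _ /=; exact: bfZl.
Qed.

Lemma gtens_addA : associative gtens_add.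
Proof. by move=> t u v; apply: gtens_sep => V b; rewrite !liftD addrA. Qed.

Lemma gtens_addC : commutative gtens_add.
Proof. by move=> t u; apply: gtens_sep => V b; rewrite !liftD addrC. Qed.

Lemma gtens_add0 : left_id gtens0 gtens_add.
Proof. by move=> t; apply: gtens_sep => V b; rewrite liftD lift0 add0r. Qed.

Lemma gtens_addN : left_inverse gtens0 (gtens_scale (-1)) gtens_add.
Proof.
by move=> t; apply: gtens_sep => V b; rewrite liftD lift0 liftZ scaleN1r addNr.
Qed.

HB.instance Definition _ :=
  GRing.isZmodule.Build gtens gtens_addA gtens_addC gtens_add0 gtens_addN.

Lemma gtens_scaleA a b t : gtens_scale a (gtens_scale b t) = gtens_scale (a * b) t.
Proof. by apply: gtens_sep => V f; rewrite !liftZ scalerA. Qed.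

Lemma gtens_scale1 : left_id 1 gtens_scale.
Proof. by move=> t; apply: gtens_sep => V f; rewrite liftZ scale1r. Qed.

Lemma gtens_scaleDr : right_distributive gtens_scale +%R.
Proof.
by move=> a t u; apply: gtens_sep => V f; rewrite liftZ !liftD !liftZ scalerDr.
Qed.

Lemma gtens_scaleDl t : {morph gtens_scale^~ t : a b / a + b}.
Proof.
by move=> a b; apply: gtens_sep => V f; rewrite liftD !liftZ scalerDl.
Qed.

HB.instance Definition _ := GRing.Zmodule_isLmodule.Build k gtens
  gtens_scaleA gtens_scale1 gtens_scaleDr gtens_scaleDl.

Lemma tlift_linear V (b : bifam V) : linear (tlift b).
Proof. by move=> a t u; rewrite liftD liftZ. Qed.

HB.instance Definition _ V (b : bifam V) :=
  GRing.isLinear.Build k gtens V _ (tlift b) (tlift_linear b).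

Definition pure_tens i j (e : i + j = n) (x : P i) (y : Q j) : gtens :=
  \pi_gtens [:: existT (fun ij => (P (sval ij).1 * Q (sval ij).2)%type)
     (exist (fun ij : int * int => ij.1 + ij.2 == n) (i, j) (introT eqP e))
     (x, y)].

Lemma tlift_pure V (b : bifam V) i j (e : i + j = n) x y :
  tlift b (pure_tens e x y) = b i j e x y.
Proof.
rewrite tlift_pi /fsum_eval big_seq1 /=.
by congr (b _ _ _ _ _); exact: Prop_irrelevance.
Qed.

Lemma pure_linearl i j (e : i + j = n) y : linear (fun x => pure_tens e x y).
Proof.
move=> a x x'; apply: gtens_sep => V b.
rewrite tlift_linear !tlift_pure; exact: (bf_linearl b e y).
Qed.

Lemma pure_linearr i j (e : i + j = n) x : linear (pure_tens e x).
Proof.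
move=> a y y'; apply: gtens_sep => V b.
rewrite tlift_linear !tlift_pure; exact: (bf_linearr b e x).
Qed.

Lemma gtens_ind (S : gtens -> Prop) : S 0 ->
  (forall t u, S t -> S u -> S (t + u)) ->
  (forall i j (e : i + j = n) x y, S (pure_tens e x y)) -> forall t, S t.
Proof.
move=> S0 SD Sp t; rewrite -[t]reprK; elim: (repr t) => [|g s IH].
  exact: S0.
suff -> : \pi_gtens (g :: s)
  = pure_tens (eqP (svalP (tag g))) (tagged g).1 (tagged g).2 + \pi_gtens s.
  exact: SD.
apply: gtens_sep => V b; rewrite liftD tlift_pure !tlift_pi.
by rewrite /fsum_eval big_cons.
Qed.

Lemma gtens_ext (V : lmodType k) (f g : gtens -> V) : linear f -> linear g ->
  (forall i j (e : i + j = n) x y,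
    f (pure_tens e x y) = g (pure_tens e x y)) -> f =1 g.
Proof.
move=> lf lg h.
have f0 (u : gtens -> V) : linear u -> u 0 = 0.
  by move=> lu; rewrite -[X in u X](subrr 0) (zmod_morphism_linear lu) subrr.
move=> t; elim/gtens_ind: t => [|t u ht hu|]; first by rewrite !f0.
  by rewrite -[t]scale1r lf lg ht hu.
exact: h.
Qed.
End GradedTensor.

Section PureTensors.
Variables (k : fieldType) (P Q : int -> lmodType k).

Lemma pure_irr n i j (e e' : i + j = n) (x : P i) (y : Q j) :
  pure_tens e x y = pure_tens e' x y.
Proof. by rewrite (Prop_irrelevance e e'). Qed.

Lemma pureDl n i j (e : i + j = n) (x x' : P i) (y : Q j) :
  pure_tens e (x + x') y = pure_tens e x y + pure_tens e x' y.
Proof. by have := pure_linearl e y 1 x x'; rewrite /= !scale1r. Qed.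

Lemma pureBl n i j (e : i + j = n) (x x' : P i) (y : Q j) :
  pure_tens e (x - x') y = pure_tens e x y - pure_tens e x' y.
Proof. exact: (zmod_morphism_linear (pure_linearl e y)). Qed.

Lemma pureZl n i j (e : i + j = n) a (x : P i) (y : Q j) :
  pure_tens e (a *: x) y = a *: pure_tens e x y.
Proof. exact: (scalable_linear (pure_linearl e y)). Qed.

Lemma pure0l n i j (e : i + j = n) (y : Q j) :
  pure_tens e (0 : P i) y = 0.
Proof. by rewrite -(scale0r (0 : P i)) pureZl scale0r. Qed.

Lemma pureDr n i j (e : i + j = n) (x : P i) (y y' : Q j) :
  pure_tens e x (y + y') = pure_tens e x y + pure_tens e x y'.
Proof. by have := pure_linearr e x 1 y y'; rewrite /= !scale1r. Qed.

Lemma pureBr n i j (e : i + j = n) (x : P i) (y y' : Q j) :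
  pure_tens e x (y - y') = pure_tens e x y - pure_tens e x y'.
Proof. exact: (zmod_morphism_linear (pure_linearr e x)). Qed.

Lemma pureZr n i j (e : i + j = n) a (x : P i) (y : Q j) :
  pure_tens e x (a *: y) = a *: pure_tens e x y.
Proof. exact: (scalable_linear (pure_linearr e x)). Qed.

Lemma pure0r n i j (e : i + j = n) (x : P i) :
  pure_tens e x (0 : Q j) = 0.
Proof. by rewrite -(scale0r (0 : Q j)) pureZr scale0r. Qed.

Lemma pure_castl n i j i' (e : i + j = n) (e' : i' + j = n) (ei : i = i')
    (x : P i) (y : Q j) :
  pure_tens e' (eq_rect i (fun h => P h) x i' ei) y = pure_tens e x y.
Proof. by case: _ / ei e' => e' /=; exact: pure_irr. Qed.

Lemma pure_castr n i j j' (e : i + j = n) (e' : i + j' = n) (ej : j = j')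
    (x : P i) (y : Q j) :
  pure_tens e' x (eq_rect j (fun h => Q h) y j' ej) = pure_tens e x y.
Proof. by case: _ / ej e' => e' /=; exact: pure_irr. Qed.
End PureTensors.

(* The sign (-1)^i for an integer i. *)
Section Sign.
Variable k : fieldType.

Definition sg (i : int) : k := (-1) ^ i.

Lemma sgD i j : sg (i + j) = sg i * sg j.
Proof. by rewrite /sg expfzDr // oppr_eq0 oner_eq0. Qed.

Lemma sg0 : sg 0 = 1. Proof. exact: expr0z. Qed.

Lemma sg1 : sg 1 = -1. Proof. exact: expr1z. Qed.

Lemma sgN i : sg (- i) = sg i.
Proof. by rewrite /sg -exprz_inv invrN1. Qed.

Lemma sgK i : sg i * sg i = 1.
Proof. by rewrite -[X in X * _]sgN -sgD addNr sg0. Qed.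

Lemma sgB1 i : sg (i - 1) = - sg i.
Proof. by rewrite sgD sgN sg1 mulrN1. Qed.
End Sign.
Arguments sg {k} i.

(* The differential lowers degrees by 1; it is given as a map P_i -> P_j for
   every proof of i = j + 1, which avoids transports between degrees. *)
Record cplx (k : fieldType) := Cplx {
  gr :> int -> lmodType k;
  diff : forall i j, i = j + 1 -> gr i -> gr j;
  diff_linear : forall i j (e : i = j + 1), linear (diff e);
  diff_diff : forall i j l (e : i = j + 1) (e' : j = l + 1) x,
    diff e' (diff e x) = 0
}.
Arguments diff {k c i j} e x : simpl never.

HB.instance Definition _ k (P : cplx k) i j (e : i = j + 1) :=
  GRing.isLinear.Build k (P i) (P j) _ (diff e) (diff_linear (c := P) e).

Lemma pred_deg (i : int) : i = i - 1 + 1.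
Proof. by rewrite subrK. Qed.

Record cmap k (P Q : cplx k) := CMap {
  cm :> forall i, P i -> Q i;
  cm_linear : forall i, linear (@cm i);
  cm_diff : forall i j (e : i = j + 1) x, cm (diff e x) = diff e (cm x)
}.
Arguments cm {k P Q} c i x.

HB.instance Definition _ k (P Q : cplx k) (f : cmap P Q) i :=
  GRing.isLinear.Build k (P i) (Q i) _ (cm f i) (@cm_linear k P Q f i).

Lemma cmap_eq k (P Q : cplx k) (f g : cmap P Q) :
  (forall i x, f i x = g i x) -> f = g.
Proof.
case: f g => [f lf df] [g lg dg] /= h.
have e : f = g.
  by apply: functional_extensionality_dep => i; apply: funext => x; exact: h.
by subst g; rewrite (Prop_irrelevance lf lg) (Prop_irrelevance df dg).
Qed.

Section ChainMaps.
Variables (k : fieldType) (P Q R : cplx k).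

Definition cid : cmap P P.
Proof. by refine (@CMap k P P (fun i => id) _ _). Defined.

Lemma ccomp_linear (g : cmap Q R) (f : cmap P Q) i :
  linear (fun x => g i (f i x)).
Proof. by move=> a x y; rewrite !linearP. Qed.

Lemma ccomp_diff (g : cmap Q R) (f : cmap P Q) i j (e : i = j + 1) x :
  g j (f j (diff e x)) = diff e (g i (f i x)).
Proof. by rewrite !cm_diff. Qed.

Definition ccomp (g : cmap Q R) (f : cmap P Q) : cmap P R :=
  CMap (@ccomp_linear g f) (@ccomp_diff g f).
End ChainMaps.

Definition cplx_cat (k : fieldType) : category.
Proof.
refine (@Category (cplx k) (@cmap k) (@cid k) (@ccomp k) _ _ _);
  by move=> *; exact: cmap_eq.
Defined.

Lemma ccompE k (P Q R : cplx k) (g : cmap Q R) (f : cmap P Q) i x :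
  ccomp g f i x = g i (f i x).
Proof. by []. Qed.

Lemma cidE k (P : cplx k) i x : cid P i x = x.
Proof. by []. Qed.

Lemma diffZ k (P : cplx k) i j (e : i = j + 1) a (x : P i) :
  diff e (a *: x) = a *: diff e x.
Proof. exact: linearZ. Qed.

Lemma diffD k (P : cplx k) i j (e : i = j + 1) (x y : P i) :
  diff e (x + y) = diff e x + diff e y.
Proof. exact: linearD. Qed.

Lemma diffN k (P : cplx k) i j (e : i = j + 1) (x : P i) :
  diff e (- x) = - diff e x.
Proof. exact: linearN. Qed.

Lemma cmB k (P Q : cplx k) (f : cmap P Q) i (x y : P i) :
  f i (x - y) = f i x - f i y.
Proof. exact: linearB. Qed.

Lemma cmZ k (P Q : cplx k) (f : cmap P Q) i a (x : P i) :
  f i (a *: x) = a *: f i x.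
Proof. exact: linearZ. Qed.

(* d (x (x) y) = d x (x) y + (-1)^|x| x (x) d y *)
Section TensorComplex.
Variables (k : fieldType) (P Q : cplx k).

Lemma deg_predl (i j n m : int) : i + j = n -> n = m + 1 -> (i - 1) + j = m.
Proof. by move=> <- h; rewrite addrAC h addrK. Qed.

Lemma deg_predr (i j n m : int) : i + j = n -> n = m + 1 -> i + (j - 1) = m.
Proof. by move=> <- h; rewrite addrA h addrK. Qed.

Definition tdiff_bifam n m (e : n = m + 1) : bifam P Q n (gtens P Q m).
Proof.
refine (@Bifam k P Q n (gtens P Q m) (fun i j eij x y =>
    pure_tens (deg_predl eij e) (diff (pred_deg i) x) y
    + sg i *: pure_tens (deg_predr eij e) x (diff (pred_deg j) y)) _ _).
- move=> i j eij y a x x' /=.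
  by rewrite linearP !pureDl !pureZl !scalerDr addrACA !scalerA mulrC.
- move=> i j eij x a y y' /=.
  by rewrite linearP !pureDr !pureZr !scalerDr addrACA !scalerA mulrC.
Defined.

Definition tcplx : cplx k.
Proof.
refine (@Cplx k (fun n => gtens P Q n : lmodType k)
  (fun n m e => tlift (tdiff_bifam e)) _ _).
- by move=> n m e; exact: tlift_linear.
- move=> n m l e e'; elim/gtens_ind => [|t u ht hu|i j eij x y].
  + by rewrite !linear0.
  + by rewrite !linearD /= ht hu addr0.
  + rewrite tlift_pure /= linearD linearZ /= !tlift_pure /=.
    rewrite !diff_diff pure0l pure0r add0r scaler0 addr0 sgB1 scaleNr.
    by rewrite (pure_irr _ (deg_predl (deg_predr eij e) e')) addNr.
Defined.
End TensorComplex.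

Lemma tdiff_pure k (P Q : cplx k) n m (e : n = m + 1) i j (eij : i + j = n)
    (x : P i) (y : Q j) :
  diff (c := tcplx P Q) e (pure_tens eij x y)
  = pure_tens (deg_predl eij e) (diff (pred_deg i) x) y
    + sg i *: pure_tens (deg_predr eij e) x (diff (pred_deg j) y).
Proof. exact: tlift_pure. Qed.

Lemma cmap_ext2 k (P Q R : cplx k) (f g : cmap (tcplx P Q) R) :
  (forall i j (x : P i) (y : Q j),
     f _ (pure_tens (erefl (i + j)) x y) = g _ (pure_tens erefl x y)) ->
  f = g.
Proof.
move=> h; apply: cmap_eq => n t.
apply: (gtens_ext (@cm_linear _ _ _ f n) (@cm_linear _ _ _ g n)) => i j e x y.
by subst n; exact: h.
Qed.

Lemma cmap_ext3 k (P Q R S : cplx k) (f g : cmap (tcplx (tcplx P Q) R) S) :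
  (forall i j l (x : P i) (y : Q j) (z : R l),
     f _ (pure_tens (P := tcplx P Q) (erefl (i + j + l)) (pure_tens erefl x y) z)
     = g _ (pure_tens (P := tcplx P Q) erefl (pure_tens erefl x y) z)) ->
  f = g.
Proof.
move=> h; apply: cmap_ext2 => m l t z.
elim/gtens_ind: t => [|t u ht hu|i j e x y].
- by rewrite !pure0l !linear0.
- by rewrite !pureDl !linearD /= ht hu.
- by subst m; exact: h.
Qed.

Lemma cmap_ext3r k (P Q R S : cplx k) (f g : cmap (tcplx P (tcplx Q R)) S) :
  (forall i j l (x : P i) (y : Q j) (z : R l),
     f _ (pure_tens (Q := tcplx Q R) (erefl (i + (j + l))) x (pure_tens erefl y z))
     = g _ (pure_tens (Q := tcplx Q R) erefl x (pure_tens erefl y z))) ->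
  f = g.
Proof.
move=> h; apply: cmap_ext2 => i m x t.
elim/gtens_ind: t => [|t u ht hu|j l e y z].
- by rewrite !pure0r !linear0.
- by rewrite !pureDr !linearD /= ht hu.
- by subst m; exact: h.
Qed.

Lemma cmap_ext4 k (P Q R S T : cplx k)
    (f g : cmap (tcplx (tcplx (tcplx P Q) R) S) T) :
  (forall i j l h (x : P i) (y : Q j) (z : R l) (t : S h),
     f _ (pure_tens (P := tcplx (tcplx P Q) R) (erefl (i + j + l + h))
            (pure_tens (P := tcplx P Q) erefl (pure_tens erefl x y) z) t)
     = g _ (pure_tens (P := tcplx (tcplx P Q) R) erefl
            (pure_tens (P := tcplx P Q) erefl (pure_tens erefl x y) z) t)) ->
  f = g.
Proof.
move=> hh; apply: cmap_ext3 => m l h u z t.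
elim/gtens_ind: u => [|u v hu hv|i j e x y].
- by rewrite !pure0l !linear0.
- by rewrite !pureDl !linearD /= hu hv.
- by subst m; exact: hh.
Qed.

Section TensorMap.
Variables (k : fieldType) (P P' Q Q' : cplx k).
Variables (f : cmap P P') (g : cmap Q Q').

Definition tmap_bifam n : bifam P Q n (gtens P' Q' n).
Proof.
refine (@Bifam k P Q n (gtens P' Q' n)
  (fun i j e x y => pure_tens e (f i x) (g j y)) _ _).
- by move=> i j e y a x x'; rewrite linearP pureDl pureZl.
- by move=> i j e x a y y'; rewrite linearP pureDr pureZr.
Defined.

Definition tmap : cmap (tcplx P Q) (tcplx P' Q').
Proof.
refine (@CMap k (tcplx P Q) (tcplx P' Q') (fun n => tlift (tmap_bifam n)) _ _).
- by move=> n; exact: tlift_linear.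
- move=> n m e; elim/gtens_ind => [|t u ht hu|i j eij x y].
  + by rewrite !linear0.
  + by rewrite !linearD /= ht hu.
  + rewrite tdiff_pure linearD linearZ /= !tlift_pure /= tdiff_pure.
    by rewrite !cm_diff.
Defined.

Lemma tmap_pure n i j (e : i + j = n) x y :
  tmap _ (pure_tens e x y) = pure_tens e (f i x) (g j y).
Proof. exact: tlift_pure. Qed.
End TensorMap.

Section Associator.
Variables (k : fieldType) (P Q R : cplx k).

Lemma deg_assoc (i j m l n : int) : i + j = m -> m + l = n -> i + (j + l) = n.
Proof. by move=> <- <-; rewrite addrA. Qed.

Lemma deg_assocV (i j m l n : int) : j + l = m -> i + m = n -> i + j + l = n.
Proof. by move=> <- <-; rewrite addrA. Qed.

Definition assoc_bifam1 n m l (e : m + l = n) (z : R l) :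
  bifam P Q m (gtens P (tcplx Q R) n).
Proof.
refine (@Bifam k P Q m (gtens P (tcplx Q R) n)
  (fun i j eij x y => pure_tens (deg_assoc eij e) x
     (pure_tens (erefl (j + l)) y z : tcplx Q R (j + l))) _ _).
- by move=> i j eij y a x x'; rewrite pureDl pureZl.
- move=> i j eij x a y y'; rewrite -pureZr -pureDr; congr pure_tens.
  by rewrite pureDl pureZl.
Defined.

Definition assoc_bifam n : bifam (tcplx P Q) R n (gtens P (tcplx Q R) n).
Proof.
refine (@Bifam k (tcplx P Q) R n (gtens P (tcplx Q R) n)
  (fun m l e t z => tlift (assoc_bifam1 e z) t) _ _).
- by move=> m l e z; exact: tlift_linear.
- move=> m l e t a z z'; elim/gtens_ind: t => [|t u ht hu|i j eij x y].
  + by rewrite !linear0 addr0.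
  + by rewrite !(linearD (tlift _)) /= ht hu scalerDr addrACA.
  + rewrite !tlift_pure /= -pureZr -pureDr; congr pure_tens.
    by rewrite pureDr pureZr.
Defined.

Definition assocV_bifam1 n m i (e : i + m = n) (x : P i) :
  bifam Q R m (gtens (tcplx P Q) R n).
Proof.
refine (@Bifam k Q R m (gtens (tcplx P Q) R n)
  (fun j l ejl y z => pure_tens (deg_assocV ejl e)
     (pure_tens (erefl (i + j)) x y : tcplx P Q (i + j)) z) _ _).
- move=> j l ejl z a y y'; rewrite -pureZl -pureDl; congr pure_tens.
  by rewrite pureDr pureZr.
- by move=> j l ejl y a z z'; rewrite pureDr pureZr.
Defined.

Definition assocV_bifam n : bifam P (tcplx Q R) n (gtens (tcplx P Q) R n).
Proof.
refine (@Bifam k P (tcplx Q R) n (gtens (tcplx P Q) R n)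
  (fun i m e x t => tlift (assocV_bifam1 e x) t) _ _).
- move=> i m e t a x x'; elim/gtens_ind: t => [|t u ht hu|j l ejl y z].
  + by rewrite !linear0 addr0.
  + by rewrite !(linearD (tlift _)) /= ht hu scalerDr addrACA.
  + rewrite !tlift_pure /= -pureZl -pureDl; congr pure_tens.
    by rewrite pureDl pureZl.
- by move=> i m e x; exact: tlift_linear.
Defined.

Lemma assoc_bifam_pure n m l (e : m + l = n) i j (eij : i + j = m)
    (x : P i) (y : Q j) (z : R l) :
  tlift (assoc_bifam n) (pure_tens (P := tcplx P Q) e (pure_tens eij x y) z)
  = pure_tens (Q := tcplx Q R) (deg_assoc eij e) x (pure_tens erefl y z).
Proof. by rewrite tlift_pure /= tlift_pure. Qed.

Lemma assocV_bifam_pure n m i (e : i + m = n) j l (ejl : j + l = m)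
    (x : P i) (y : Q j) (z : R l) :
  tlift (assocV_bifam n) (pure_tens (Q := tcplx Q R) e x (pure_tens ejl y z))
  = pure_tens (P := tcplx P Q) (deg_assocV ejl e) (pure_tens erefl x y) z.
Proof. by rewrite tlift_pure /= tlift_pure. Qed.

Lemma pure3_irr n m m' i j l (e : i + m = n) (e' : i + m' = n)
    (h : j + l = m) (h' : j + l = m') (x : P i) (y : Q j) (z : R l) :
  pure_tens (Q := tcplx Q R) e x (pure_tens h y z)
  = pure_tens (Q := tcplx Q R) e' x (pure_tens h' y z).
Proof. by subst m m'; exact: pure_irr. Qed.

Lemma pure3_irrV n m m' i j l (e : m + l = n) (e' : m' + l = n)
    (h : i + j = m) (h' : i + j = m') (x : P i) (y : Q j) (z : R l) :
  pure_tens (P := tcplx P Q) e (pure_tens h x y) z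
  = pure_tens (P := tcplx P Q) e' (pure_tens h' x y) z.
Proof. by subst m m'; exact: pure_irr. Qed.

Definition tassoc : cmap (tcplx (tcplx P Q) R) (tcplx P (tcplx Q R)).
Proof.
refine (@CMap k (tcplx (tcplx P Q) R) (tcplx P (tcplx Q R))
  (fun n => tlift (assoc_bifam n)) _ _).
- by move=> n; exact: tlift_linear.
- move=> n n' e; elim/gtens_ind => [|t u ht hu|m l em t z].
  + by rewrite !linear0.
  + by rewrite !linearD /= ht hu.
  elim/gtens_ind: t => [|t u ht hu|i j eij x y].
  + by rewrite pure0l !linear0.
  + by rewrite pureDl !linearD /= ht hu.
  rewrite assoc_bifam_pure !tdiff_pure pureDl pureZl !linearD !linearZ /=.
  rewrite !assoc_bifam_pure pureDr pureZr.
  rewrite -addrA scalerDr scalerA -sgD eij; congr (_ + (_ *: _ + _ *: _));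
  exact: pure3_irr.
Defined.

Definition tassocV : cmap (tcplx P (tcplx Q R)) (tcplx (tcplx P Q) R).
Proof.
refine (@CMap k (tcplx P (tcplx Q R)) (tcplx (tcplx P Q) R)
  (fun n => tlift (assocV_bifam n)) _ _).
- by move=> n; exact: tlift_linear.
- move=> n n' e; elim/gtens_ind => [|t u ht hu|i m em x t].
  + by rewrite !linear0.
  + by rewrite !linearD /= ht hu.
  elim/gtens_ind: t => [|t u ht hu|j l ejl y z].
  + by rewrite pure0r !linear0.
  + by rewrite pureDr !linearD /= ht hu.
  rewrite assocV_bifam_pure !tdiff_pure pureDr pureZr !linearD !linearZ /=.
  rewrite !assocV_bifam_pure pureDl pureZl.
  rewrite -[RHS]addrA scalerA -sgD; congr (_ + (_ *: _ + _ *: _));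
  exact: pure3_irrV.
Defined.
End Associator.

Section Braiding.
Variables (k : fieldType) (P Q : cplx k).

Lemma deg_braid (i j n : int) : i + j = n -> j + i = n.
Proof. by rewrite addrC. Qed.

Definition braid_bifam n : bifam P Q n (gtens Q P n).
Proof.
refine (@Bifam k P Q n (gtens Q P n)
  (fun i j e x y => sg (i * j) *: pure_tens (deg_braid e) y x) _ _).
- move=> i j e y a x x'.
  by rewrite pureDr pureZr scalerDr !scalerA mulrC.
- move=> i j e x a y y'.
  by rewrite pureDl pureZl scalerDr !scalerA mulrC.
Defined.

(* x (x) y |-> (-1)^(|x||y|) y (x) x *)
Definition tbraid : cmap (tcplx P Q) (tcplx Q P).
Proof.
refine (@CMap k (tcplx P Q) (tcplx Q P) (fun n => tlift (braid_bifam n)) _ _).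
- by move=> n; exact: tlift_linear.
- move=> n m e; elim/gtens_ind => [|t u ht hu|i j eij x y].
  + by rewrite !linear0.
  + by rewrite !linearD /= ht hu.
  rewrite tdiff_pure (linearD (tlift _)) (linearZ_LR (tlift _)) /= !tlift_pure /=.
  rewrite diffZ tdiff_pure scalerDr !scalerA addrC; congr (_ *: _ + _ *: _).
  + by rewrite mulrBr mulr1 sgD sgN mulrCA sgK mulr1.
  + exact: pure_irr.
  + by rewrite mulrBl mul1r sgD sgN.
  + exact: pure_irr.
Defined.

Lemma tbraid_pure n i j (e : i + j = n) x y :
  tbraid _ (pure_tens e x y) = sg (i * j) *: pure_tens (deg_braid e) y x.
Proof. exact: tlift_pure. Qed.
End Braiding.

Section Unit.
Variable k : fieldType.

(* The ground field in degree 0: row vectors of length 1 in degree 0 and of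
   length 0 in all other degrees. *)
Definition unit_cplx : cplx k.
Proof.
refine (@Cplx k (fun i => 'rV[k]_(i == 0) : lmodType k)
  (fun i j e x => 0) _ _) => //.
by move=> i j e a x y; rewrite scaler0 addr0.
Defined.

Variable P : cplx k.

Definition scal i (a : unit_cplx i) : k := \sum_c (a : 'rV[k]__) 0 c.

Lemma scal_linear i : forall a (u v : unit_cplx i),
  scal (a *: u + v) = a * scal u + scal v.
Proof.
move=> a u v; rewrite /scal mulr_sumr -big_split /=.
by apply: eq_bigr => c _; rewrite !mxE.
Qed.

Lemma scal_neq0 i (a : unit_cplx i) : i != 0 -> scal a = 0.
Proof.
by move=> i0; rewrite /scal; apply: big1 => -[c hc] _; exfalso; move: hc; rewrite (negPf i0).
Qed.

Lemma scal0 i : scal (0 : unit_cplx i) = 0.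
Proof. by rewrite /scal; apply: big1 => c _; rewrite mxE. Qed.

(* The identity of P_i if i = j, and 0 otherwise. *)
Definition tocast j i (x : P i) : P j :=
  match i =P j with
  | ReflectT e => eq_rect i (fun h => P h) x j e
  | ReflectF _ => 0
  end.

Lemma tocast_id i (x : P i) : tocast i x = x.
Proof.
rewrite /tocast; case: eqP => // e.
by rewrite (Prop_irrelevance e erefl).
Qed.

Lemma tocast_linear j i : linear (@tocast j i).
Proof.
move=> a x y; rewrite /tocast; case: eqP => [e|_]; last by rewrite scaler0 addr0.
by subst j.
Qed.

Lemma tocast_diff i j i' (e : j = i' + 1) (e' : i = j) (x : P i) :
  tocast i' (diff (pred_deg i) x) = diff e (tocast j x).
Proof.
subst i; rewrite tocast_id.
have ei : j - 1 = i' by rewrite e addrK.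
by case: _ / ei e => e; rewrite tocast_id (Prop_irrelevance e (pred_deg j)).
Qed.

Definition lunit_bifam n : bifam unit_cplx P n (P n).
Proof.
refine (@Bifam k unit_cplx P n (P n)
  (fun i j e a x => scal a *: tocast n x) _ _).
- by move=> i j e y a x x'; rewrite scal_linear scalerDl scalerA.
- move=> i j e x a y y'.
  by rewrite tocast_linear scalerDr !scalerA mulrC.
Defined.

Definition runit_bifam n : bifam P unit_cplx n (P n).
Proof.
refine (@Bifam k P unit_cplx n (P n)
  (fun i j e x a => scal a *: tocast n x) _ _).
- move=> i j e x a y y'.
  by rewrite tocast_linear scalerDr !scalerA mulrC.
- by move=> i j e y a x x'; rewrite scal_linear scalerDl scalerA.
Defined.

Definition tlunit : cmap (tcplx unit_cplx P) P.
Proof.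
refine (@CMap k (tcplx unit_cplx P) P (fun n => tlift (lunit_bifam n)) _ _).
- by move=> n; exact: tlift_linear.
- move=> n m e; elim/gtens_ind => [|t u ht hu|i j eij a x].
  + by rewrite !linear0.
  + by rewrite !linearD /= ht hu.
  rewrite tdiff_pure (linearD (tlift _)) (linearZ_LR (tlift _)) /= !tlift_pure /=.
  rewrite scal0 scale0r add0r diffZ.
  have [i0|i0] := eqVneq i 0; last by rewrite scal_neq0 // !scale0r scaler0.
  subst i; rewrite sg0 scale1r; congr (_ *: _); apply: tocast_diff.
  by rewrite -eij add0r.
Defined.

Definition trunit : cmap (tcplx P unit_cplx) P.
Proof.
refine (@CMap k (tcplx P unit_cplx) P (fun n => tlift (runit_bifam n)) _ _).
- by move=> n; exact: tlift_linear.
- move=> n m e; elim/gtens_ind => [|t u ht hu|i j eij x a].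
  + by rewrite !linear0.
  + by rewrite !linearD /= ht hu.
  rewrite tdiff_pure (linearD (tlift _)) (linearZ_LR (tlift _)) /= !tlift_pure /=.
  rewrite scal0 scale0r scaler0 addr0 diffZ.
  have [j0|j0] := eqVneq j 0; last by rewrite scal_neq0 // !scale0r.
  subst j; congr (_ *: _); apply: tocast_diff.
  by rewrite -eij addr0.
Defined.

Definition unit1 : unit_cplx 0 := const_mx 1.

Lemma scal_unit1 : scal unit1 = 1.
Proof. by rewrite /scal /unit1 /= big_ord1 mxE. Qed.

Lemma unit_scal (a : unit_cplx 0) : a = scal a *: unit1.
Proof.
apply/rowP => c; rewrite !mxE /scal /= big_ord1 mulr1; congr ((a : 'rV[k]_1) _ _).
by rewrite (ord1 c).
Qed.

Lemma unit_neq0 i (a : unit_cplx i) : i != 0 -> a = 0.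
Proof.
by move=> i0; apply/rowP => -[c hc]; exfalso; move: hc; rewrite (negPf i0).
Qed.

Definition tlunitV : cmap P (tcplx unit_cplx P).
Proof.
refine (@CMap k P (tcplx unit_cplx P)
  (fun n x => pure_tens (add0r n) unit1 x) _ _).
- by move=> n; exact: pure_linearr.
- move=> n m e x; rewrite tdiff_pure [diff _ unit1]/(0) pure0l add0r sg0 scale1r.
  have em : n - 1 = m by rewrite e addrK.
  case: _ / em e => e; rewrite (Prop_irrelevance e (pred_deg n)).
  exact: pure_irr.
Defined.

Definition trunitV : cmap P (tcplx P unit_cplx).
Proof.
refine (@CMap k P (tcplx P unit_cplx)
  (fun n x => pure_tens (addr0 n) x unit1) _ _).
- by move=> n; exact: pure_linearl.
- move=> n m e x; rewrite tdiff_pure [diff _ unit1]/(0) pure0r scaler0 addr0.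
  have em : n - 1 = m by rewrite e addrK.
  case: _ / em e => e; rewrite (Prop_irrelevance e (pred_deg n)).
  exact: pure_irr.
Defined.

Lemma tlunitVE n x : tlunitV n x = pure_tens (add0r n) unit1 x.
Proof. by []. Qed.

Lemma trunitVE n x : trunitV n x = pure_tens (addr0 n) x unit1.
Proof. by []. Qed.

Lemma tlunit_pure n i j (e : i + j = n) a x :
  tlunit _ (pure_tens e a x) = scal a *: tocast n x.
Proof. exact: tlift_pure. Qed.

Lemma trunit_pure n i j (e : i + j = n) x a :
  trunit _ (pure_tens e x a) = scal a *: tocast n x.
Proof. exact: tlift_pure. Qed.
End Unit.
Arguments unit_cplx {k}.

Section Pure4.
Variables (k : fieldType) (P Q R S : cplx k).
Lemma pure4_irr n m m' o o' i j l h (e : i + m = n) (e' : i + m' = n)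
    (f : j + o = m) (f' : j + o' = m') (g : l + h = o) (g' : l + h = o')
    (x : P i) (y : Q j) (z : R l) (t : S h) :
  pure_tens (Q := tcplx Q (tcplx R S)) e x
    (pure_tens (Q := tcplx R S) f y (pure_tens g z t))
  = pure_tens (Q := tcplx Q (tcplx R S)) e' x
    (pure_tens (Q := tcplx R S) f' y (pure_tens g' z t)).
Proof. by subst o o' m m'; exact: pure_irr. Qed.
End Pure4.

Lemma tocast_nat k (P Q : cplx k) (f : cmap P Q) j i (x : P i) :
  tocast j (f i x) = f j (tocast j x).
Proof. by rewrite /tocast; case: eqP => [e|_]; [subst j | rewrite linear0]. Qed.

Lemma tassoc_pure k (P Q R : cplx k) n m l (e : m + l = n) i j
    (eij : i + j = m) (x : P i) (y : Q j) (z : R l) :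
  tassoc P Q R _ (pure_tens (P := tcplx P Q) e (pure_tens eij x y) z)
  = pure_tens (Q := tcplx Q R) (deg_assoc eij e) x (pure_tens erefl y z).
Proof. exact: assoc_bifam_pure. Qed.

Lemma tassocV_pure k (P Q R : cplx k) n m i (e : i + m = n) j l
    (ejl : j + l = m) (x : P i) (y : Q j) (z : R l) :
  tassocV P Q R _ (pure_tens (Q := tcplx Q R) e x (pure_tens ejl y z))
  = pure_tens (P := tcplx P Q) (deg_assocV ejl e) (pure_tens erefl x y) z.
Proof. exact: assocV_bifam_pure. Qed.

Definition cplx_smcat (k : fieldType) : smcat.
Proof.
refine (@SMCat (cplx_cat k) (@tcplx k) (fun P P' Q Q' f g => tmap f g)
  unit_cplx (@tassoc k) (@tassocV k) (@tlunit k) (@tlunitV k) (@trunit k)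
  (@trunitV k) (@tbraid k) _ _ _ _ _ _ _ _ _ _ _ _ _ _ _ _).
- by move=> P Q; apply: cmap_ext2 => i j x y; rewrite tmap_pure !cidE.
- move=> P P' P'' Q Q' Q'' f' f g' g; apply: cmap_ext2 => i j x y.
  by rewrite !ccompE ?cidE !tmap_pure.
- move=> P P' Q Q' R R' f g h; apply: cmap_ext3 => i j l x y z.
  by rewrite !ccompE tmap_pure !tassoc_pure tmap_pure !tmap_pure tassoc_pure.
- move=> P P' f; apply: cmap_ext2 => i j x y.
  by rewrite !ccompE ?cidE tmap_pure !tlunit_pure cmZ tocast_nat.
- move=> P P' f; apply: cmap_ext2 => i j x y.
  by rewrite !ccompE ?cidE tmap_pure !trunit_pure cmZ tocast_nat.
- move=> P P' Q Q' f g; apply: cmap_ext2 => i j x y.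
  by rewrite !ccompE ?cidE tmap_pure !tbraid_pure cmZ tmap_pure.
- move=> P Q R; apply: cmap_ext3 => i j l x y z.
  rewrite !ccompE ?cidE tassoc_pure tassocV_pure; exact: pure3_irrV.
- move=> P Q R; apply: cmap_ext3r => i j l x y z.
  rewrite !ccompE ?cidE tassocV_pure tassoc_pure; exact: pure3_irr.
- move=> P; apply: cmap_ext2 => i j a x.
  rewrite !ccompE ?cidE tlunit_pure tlunitVE pureZr -pureZl.
  have [i0|i0] := eqVneq i 0; last by rewrite scal_neq0 // (unit_neq0 a) // scale0r !pure0l.
  subst i; rewrite -unit_scal.
  have h : j = 0 + j by rewrite add0r.
  by rewrite /tocast; case: eqP => // e; exact: pure_castr.
- by move=> P; apply: cmap_eq => i x; rewrite ccompE tlunitVE tlunit_pure scal_unit1 scale1r tocast_id.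
- move=> P; apply: cmap_ext2 => i j x a.
  rewrite !ccompE ?cidE trunit_pure trunitVE pureZl -pureZr.
  have [j0|j0] := eqVneq j 0; last by rewrite scal_neq0 // (unit_neq0 a) // scale0r !pure0r.
  subst j; rewrite -unit_scal.
  have h : i = i + 0 by rewrite addr0.
  by rewrite /tocast; case: eqP => // e; exact: pure_castl.
- by move=> P; apply: cmap_eq => i x; rewrite ccompE trunitVE trunit_pure scal_unit1 scale1r tocast_id.
- move=> P Q; apply: cmap_ext2 => i j x y.
  rewrite !ccompE ?cidE tbraid_pure cmZ tbraid_pure scalerA [j * i]mulrC sgK scale1r.
  exact: pure_irr.
- move=> P Q R S; apply: cmap_ext4 => i j l h x y z t.
  rewrite !ccompE ?cidE !tassoc_pure !tmap_pure !tassoc_pure tmap_pure tassoc_pure.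
  exact: pure4_irr.
- move=> P Q; apply: cmap_ext3 => i j l x a y.
  rewrite !ccompE ?cidE tassoc_pure !tmap_pure tlunit_pure trunit_pure ?cidE pureZr pureZl.
  have [j0|j0] := eqVneq j 0; last by rewrite scal_neq0 // !scale0r.
  congr (_ *: _); subst j.
  have h : i = i + 0 by rewrite addr0.
  have h' : l = 0 + l by rewrite add0r.
  rewrite /tocast; case: eqP => // e1; case: eqP => // e2.
  have e : i + l = i + 0 + l by rewrite addr0.
  by rewrite (pure_castr e) (pure_castl e).
- move=> P Q R; apply: cmap_ext3 => i j l x y z.
  rewrite !ccompE ?cidE tassoc_pure tbraid_pure tmap_pure tbraid_pure !pureZl !cmZ.
  rewrite !tassoc_pure tmap_pure tbraid_pure pureZr scalerA mulrDr sgD.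
  congr (_ *: _); exact: pure3_irr.
Defined.

Section Cycles.
Variables (k : fieldType) (P : cplx k) (i : int).

Definition is_cycle : {pred P i} := fun x => diff (pred_deg i) x == 0.

Lemma is_cycle_closed : subsemimod_closed is_cycle.
Proof.
split; [split|].
- by rewrite unfold_in /is_cycle linear0.
- move=> x y; rewrite !unfold_in /is_cycle diffD => /eqP -> /eqP ->.
  by rewrite addr0.
- by move=> a x; rewrite !unfold_in /is_cycle diffZ => /eqP ->; rewrite scaler0.
Qed.
HB.instance Definition _ :=
  GRing.isSubmodClosed.Build k (P i) is_cycle is_cycle_closed.

Record cycle := Cycle { cval :> P i; cvalP : cval \in is_cycle }.
HB.instance Definition _ := [isSub for cval].
HB.instance Definition _ := [Choice of cycle by <:].
HB.instance Definition _ := [SubChoice_isSubLmodule of cycle by <:].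

Lemma is_cycleP j (e : i = j + 1) (x : P i) :
  reflect (diff e x = 0) (x \in is_cycle).
Proof.
have ej : i - 1 = j by rewrite e addrK.
case: _ / ej e => e; rewrite (Prop_irrelevance e (pred_deg i)); exact: eqP.
Qed.

Definition homologous : rel cycle := fun x y =>
  `[< exists z : P (i + 1), val x - val y = diff erefl z >].

Lemma homologous_refl : reflexive homologous.
Proof. by move=> x; apply/asboolP; exists 0; rewrite subrr linear0. Qed.

Lemma homologous_sym : symmetric homologous.
Proof.
by move=> x y; apply/asboolP/asboolP => -[z h]; exists (- z);
  rewrite diffN -h opprB.
Qed.

Lemma homologous_trans : transitive homologous.
Proof.
move=> y x z /asboolP[u hu] /asboolP[v hv]; apply/asboolP; exists (u + v).
by rewrite diffD -hu -hv addrA subrK.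
Qed.

Canonical homologous_equiv :=
  EquivRel homologous homologous_refl homologous_sym homologous_trans.

Definition hgr := {eq_quot homologous}.
HB.instance Definition _ := Choice.on hgr.
HB.instance Definition _ := EqQuotient.on hgr.

Lemma hgr_eqP (x y : cycle) :
  \pi_hgr x = \pi_hgr y <-> exists z : P (i + 1), val x - val y = diff erefl z.
Proof.
split; first by move/eqmodP/asboolP.
by move=> h; apply/eqmodP/asboolP.
Qed.

Lemma hgr_repr (x : cycle) :
  exists z : P (i + 1), val (repr (\pi_hgr x)) - val x = diff erefl z.
Proof. by apply/hgr_eqP; rewrite reprK. Qed.

Lemma hgr_ind (S : hgr -> Prop) : (forall x, S (\pi_hgr x)) -> forall a, S a.
Proof. by move=> h a; rewrite -[a]reprK. Qed.

Definition hgr0 : hgr := \pi_hgr (0 : cycle).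
Definition hgr_opp (a : hgr) : hgr := \pi_hgr (- repr a).
Definition hgr_add (a b : hgr) : hgr := \pi_hgr (repr a + repr b).
Definition hgr_scale c (a : hgr) : hgr := \pi_hgr (c *: repr a).

Let piD x y : hgr_add (\pi_hgr x) (\pi_hgr y) = \pi_hgr (x + y).
Proof.
apply/hgr_eqP; have [u hu] := hgr_repr x; have [v hv] := hgr_repr y.
by exists (u + v); rewrite diffD -hu -hv opprD addrACA.
Qed.

Let piN x : hgr_opp (\pi_hgr x) = \pi_hgr (- x).
Proof.
apply/hgr_eqP; have [u hu] := hgr_repr x.
by exists (- u); rewrite diffN -hu opprD.
Qed.

Let piZ c x : hgr_scale c (\pi_hgr x) = \pi_hgr (c *: x).
Proof.
apply/hgr_eqP; have [u hu] := hgr_repr x.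
by exists (c *: u); rewrite diffZ -hu scalerBr.
Qed.

Lemma hgr_addA : associative hgr_add.
Proof.
move=> x y z; elim/hgr_ind: x => x; elim/hgr_ind: y => y; elim/hgr_ind: z => z.
by rewrite !piD addrA.
Qed.

Lemma hgr_addC : commutative hgr_add.
Proof. by move=> x y; elim/hgr_ind: x => x; elim/hgr_ind: y => y; rewrite !piD addrC. Qed.

Lemma hgr_add0 : left_id hgr0 hgr_add.
Proof. by move=> x; elim/hgr_ind: x => x; rewrite piD add0r. Qed.

Lemma hgr_addN : left_inverse hgr0 hgr_opp hgr_add.
Proof. by move=> x; elim/hgr_ind: x => x; rewrite piN piD addNr. Qed.

HB.instance Definition _ :=
  GRing.isZmodule.Build hgr hgr_addA hgr_addC hgr_add0 hgr_addN.

Lemma hgr_scaleA a b x : hgr_scale a (hgr_scale b x) = hgr_scale (a * b) x.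
Proof. by elim/hgr_ind: x => x; rewrite !piZ scalerA. Qed.

Lemma hgr_scale1 : left_id 1 hgr_scale.
Proof. by move=> x; elim/hgr_ind: x => x; rewrite piZ scale1r. Qed.

Lemma hgr_scaleDr : right_distributive hgr_scale +%R.
Proof.
move=> a x y; elim/hgr_ind: x => x; elim/hgr_ind: y => y.
by rewrite [_ + _]piD !piZ scalerDr -piD.
Qed.

Lemma hgr_scaleDl x : {morph hgr_scale^~ x : a b / a + b}.
Proof. by move=> a b; elim/hgr_ind: x => x; rewrite !piZ scalerDl -piD. Qed.

HB.instance Definition _ := GRing.Zmodule_isLmodule.Build k hgr
  hgr_scaleA hgr_scale1 hgr_scaleDr hgr_scaleDl.

Definition hclass (x : cycle) : hgr := \pi_hgr x.

Lemma hclass_linear : linear hclass.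
Proof. by move=> a x y; rewrite /hclass -piD -piZ. Qed.

Lemma hclass_ind (S : hgr -> Prop) : (forall x, S (hclass x)) -> forall a, S a.
Proof. by move=> h a; elim/hgr_ind: a => x; exact: h. Qed.

Lemma hclass_eqP (x y : cycle) :
  hclass x = hclass y <-> exists z : P (i + 1), val x - val y = diff erefl z.
Proof. exact: hgr_eqP. Qed.

Lemma hclass_repr (x : cycle) :
  exists z : P (i + 1), val (repr (hclass x)) - val x = diff erefl z.
Proof. exact: hgr_repr. Qed.
End Cycles.
Arguments is_cycle {k} P i _.

Section HomologyComplex.
Variables (k : fieldType) (P : cplx k).

(* Homology is viewed as a complex with zero differential. *)
Definition hcplx : cplx k.
Proof.
refine (@Cplx k (fun i => hgr P i : lmodType k) (fun i j e x => 0) _ _) => //.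
by move=> i j e a x y; rewrite scaler0 addr0.
Defined.
End HomologyComplex.

Section HomologyMap.
Variables (k : fieldType) (P Q : cplx k) (f : cmap P Q).

Lemma cycle_map_subproof i (x : cycle P i) : f i x \in is_cycle Q i.
Proof.
apply/(is_cycleP (pred_deg i)); rewrite -cm_diff.
by move/is_cycleP: (cvalP x) => ->; rewrite linear0.
Qed.

Definition cycle_map i (x : cycle P i) : cycle Q i :=
  Cycle (cycle_map_subproof x).

Definition hmap_fun i (a : hgr P i) : hgr Q i := hclass (cycle_map (repr a)).

Lemma hmap_class i (x : cycle P i) :
  hmap_fun (hclass x) = hclass (cycle_map x).
Proof.
apply/hclass_eqP; have [z hz] := hclass_repr x.
by exists (f _ z); rewrite -cm_diff -hz cmB.
Qed.

Lemma hmap_linear i : linear (@hmap_fun i).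
Proof.
move=> a x y; elim/hclass_ind: x => x; elim/hclass_ind: y => y.
rewrite -hclass_linear !hmap_class -hclass_linear; congr hclass; apply: val_inj.
exact: linearP.
Qed.

HB.instance Definition _ i :=
  GRing.isLinear.Build k (hgr P i) (hgr Q i) _ (@hmap_fun i) (@hmap_linear i).

Definition hmap : cmap (hcplx P) (hcplx Q).
Proof.
refine (@CMap k (hcplx P) (hcplx Q) hmap_fun hmap_linear _).
by move=> i j e x; rewrite [diff e x]/(0) linear0.
Defined.
End HomologyMap.

Lemma hmapE k (P Q : cplx k) (f : cmap P Q) i (x : cycle P i) :
  hmap f i (hclass x) = hclass (cycle_map f x).
Proof. exact: hmap_class. Qed.

Definition homology_functor_cplx (k : fieldType) :
  functor (cplx_cat k) (cplx_cat k).
Proof.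
refine (@Functor (cplx_cat k) (cplx_cat k) (@hcplx k) (@hmap k) _ _).
- move=> P; apply: cmap_eq => i x; elim/hclass_ind: x => x.
  by rewrite hmapE; congr hclass; apply: val_inj.
- move=> P Q R g f; apply: cmap_eq => i x; elim/hclass_ind: x => x.
  by rewrite ccompE !hmapE; congr hclass; apply: val_inj.
Defined.

Lemma tdiff_pureE k (P Q : cplx k) n m (e : n = m + 1) i j i' j'
    (eij : i + j = n) (ei : i = i' + 1) (ej : j = j' + 1)
    (el : i' + j = m) (er : i + j' = m) (x : P i) (y : Q j) :
  diff (c := tcplx P Q) e (pure_tens eij x y)
  = pure_tens el (diff ei x) y + sg i *: pure_tens er x (diff ej y).
Proof.
have hi : i - 1 = i' by rewrite ei addrK.
have hj : j - 1 = j' by rewrite ej addrK.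
case: _ / hi ei el => ei el; case: _ / hj ej er => ej er.
rewrite tdiff_pure (Prop_irrelevance ei (pred_deg i)).
rewrite (Prop_irrelevance ej (pred_deg j)).
by congr (_ + _ *: _); exact: pure_irr.
Qed.

(* The Kuenneth morphism [x] (x) [y] |-> [x (x) y]. *)
Section Kunneth.
Variables (k : fieldType) (P Q : cplx k).

Lemma cycle_tens_subproof n i j (e : i + j = n) (x : cycle P i) (y : cycle Q j) :
  (pure_tens e (val x) (val y) : tcplx P Q n) \in is_cycle (tcplx P Q) n.
Proof.
apply/(is_cycleP (pred_deg n)); rewrite tdiff_pure.
move/(is_cycleP (pred_deg i)): (cvalP x) => /= ->.
move/(is_cycleP (pred_deg j)): (cvalP y) => /= ->.
by rewrite pure0l pure0r scaler0 addr0.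
Qed.

Definition cycle_tens n i j (e : i + j = n) (x : cycle P i) (y : cycle Q j) :
  cycle (tcplx P Q) n := Cycle (cycle_tens_subproof e x y).

Definition kunneth_fun n i j (e : i + j = n) (a : hgr P i) (b : hgr Q j) :
  hgr (tcplx P Q) n := hclass (cycle_tens e (repr a) (repr b)).

Lemma kunneth_class n i j (e : i + j = n) (x : cycle P i) (y : cycle Q j) :
  kunneth_fun e (hclass x) (hclass y) = hclass (cycle_tens e x y).
Proof.
rewrite /kunneth_fun; apply/hclass_eqP => /=.
have [u hu] := hclass_repr x; have [v hv] := hclass_repr y.
set x' := repr (hclass x); set y' := repr (hclass y).
have e1 : i + 1 + j = n + 1 by rewrite addrAC e.
have e2 : i + (j + 1) = n + 1 by rewrite addrA e.
exists ((pure_tens e1 u (val y') : tcplx P Q _)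
        + sg i *: (pure_tens e2 (val x) v : tcplx P Q _)).
have e3 : i + 1 + (j - 1) = n by rewrite addrACA subrr addr0.
have e4 : i - 1 + (j + 1) = n by rewrite addrACA addNr addr0.
rewrite diffD diffZ.
rewrite (tdiff_pureE erefl e1 erefl (pred_deg j) e e3).
rewrite (tdiff_pureE erefl e2 (pred_deg i) erefl e4 e).
move/(is_cycleP (pred_deg i)): (cvalP x) => /= ->.
move/(is_cycleP (pred_deg j)): (cvalP y') => /= ->.
rewrite pure0l pure0r scaler0 addr0 add0r scalerA sgK scale1r -hu -hv.
by rewrite pureBl pureBr addrA subrK.
Qed.

Definition kunneth_bifam n : bifam (hcplx P) (hcplx Q) n (hgr (tcplx P Q) n).
Proof.
refine (@Bifam k (hcplx P) (hcplx Q) n (hgr (tcplx P Q) n)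
  (@kunneth_fun n) _ _).
- move=> i j e b a x y; elim/hclass_ind: b => b.
  elim/hclass_ind: x => x; elim/hclass_ind: y => y.
  rewrite -hclass_linear !kunneth_class -hclass_linear.
  by congr hclass; apply: val_inj; rewrite /= pureDl pureZl.
- move=> i j e b a x y; elim/hclass_ind: b => b.
  elim/hclass_ind: x => x; elim/hclass_ind: y => y.
  rewrite -hclass_linear !kunneth_class -hclass_linear.
  by congr hclass; apply: val_inj; rewrite /= pureDr pureZr.
Defined.

Definition kunneth : cmap (tcplx (hcplx P) (hcplx Q)) (hcplx (tcplx P Q)).
Proof.
refine (@CMap k (tcplx (hcplx P) (hcplx Q)) (hcplx (tcplx P Q))
  (fun n => tlift (kunneth_bifam n)) _ _).
- by move=> n; exact: tlift_linear.
- move=> n m e t; rewrite [RHS]/(0); elim/gtens_ind: t => [|t u ht hu|i j eij a b].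
  + by rewrite !linear0.
  + by rewrite !linearD /= ht hu addr0.
  rewrite tdiff_pure [diff _ a]/(0) [diff _ b]/(0).
  by rewrite pure0l pure0r scaler0 addr0 linear0.
Defined.

Lemma kunneth_pure n i j (e : i + j = n) (x : cycle P i) (y : cycle Q j) :
  kunneth n (pure_tens (P := hcplx P) (Q := hcplx Q) e (hclass x) (hclass y))
  = hclass (cycle_tens e x y).
Proof. by rewrite [LHS]tlift_pure /= kunneth_class. Qed.
End Kunneth.

Section HomologyUnit.
Variable k : fieldType.

Lemma unit_cycle_subproof i (a : @unit_cplx k i) : a \in is_cycle unit_cplx i.
Proof. by apply/(is_cycleP (pred_deg i)). Qed.

Definition unit_cycle i (a : @unit_cplx k i) : cycle unit_cplx i :=
  Cycle (unit_cycle_subproof a).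

(* a |-> [a] *)
Definition hunit : cmap (@unit_cplx k) (hcplx unit_cplx).
Proof.
refine (@CMap k unit_cplx (hcplx unit_cplx) (fun i a => hclass (unit_cycle a)) _ _).
- move=> i a x y; rewrite -hclass_linear; congr hclass.
  exact: val_inj.
- move=> i j e x; rewrite [RHS]/(0) -[RHS]/(hclass 0); congr hclass.
  exact: val_inj.
Defined.

Lemma hunitE i (a : @unit_cplx k i) : hunit i a = hclass (unit_cycle a).
Proof. by []. Qed.
End HomologyUnit.


Section HomologyFunctor.
Variable k : fieldType.

Opaque tmap tassoc tbraid tlunit trunit hmap kunneth.

Lemma hclassZ (P : cplx k) i c (x : cycle P i) : hclass (c *: x) = c *: hclass x.
Proof. exact: (scalable_linear (@hclass_linear k P i)). Qed.

Lemma hclass_tocast (P : cplx k) j n c (b : cycle P j) (z : cycle P n) :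
  j = n -> val z = c *: tocast n (val b) ->
  hclass z = c *: tocast (P := hcplx P) n (hclass b).
Proof.
move=> e; case: _ / e z => z; rewrite !tocast_id => h.
by rewrite -hclassZ; congr hclass; exact: val_inj.
Qed.

Lemma hclass_val0 (P : cplx k) i (z : cycle P i) : val z = 0 -> hclass z = 0.
Proof. by move=> h; rewrite -[RHS]/(hclass 0); congr hclass; exact: val_inj. Qed.

Lemma kunneth_nat (P P' Q Q' : cplx k) (f : cmap P P') (g : cmap Q Q') :
  ccomp (kunneth P' Q') (tmap (hmap f) (hmap g))
  = ccomp (hmap (tmap f g)) (kunneth P Q).
Proof.
apply: cmap_ext2 => i j a b; rewrite !ccompE.
elim/hclass_ind: a => a; elim/hclass_ind: b => b.
rewrite tmap_pure !hmapE !kunneth_pure hmapE.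
by congr hclass; apply: val_inj; symmetry; exact: tmap_pure.
Qed.

Lemma kunneth_assoc (P Q R : cplx k) :
  ccomp (ccomp (hmap (tassoc P Q R)) (kunneth (tcplx P Q) R))
    (tmap (kunneth P Q) (cid (hcplx R)))
  = ccomp (ccomp (kunneth P (tcplx Q R)) (tmap (cid (hcplx P)) (kunneth Q R)))
    (tassoc (hcplx P) (hcplx Q) (hcplx R)).
Proof.
apply: cmap_ext3 => i j l a b c; rewrite !ccompE.
elim/hclass_ind: a => a; elim/hclass_ind: b => b; elim/hclass_ind: c => c.
rewrite tmap_pure kunneth_pure cidE kunneth_pure hmapE.
rewrite tassoc_pure tmap_pure cidE !kunneth_pure.
by congr hclass; apply: val_inj; exact: tassoc_pure.
Qed.

Lemma kunneth_lunit (P : cplx k) :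
  ccomp (ccomp (hmap (tlunit P)) (kunneth unit_cplx P))
    (tmap (hunit k) (cid (hcplx P)))
  = tlunit (hcplx P).
Proof.
apply: cmap_ext2 => i j a b; rewrite !ccompE.
elim/hclass_ind: b => b.
rewrite tmap_pure cidE hunitE kunneth_pure hmapE tlunit_pure.
have hv := tlunit_pure (erefl (i + j)) a (val b).
have [i0|i0] := eqVneq i 0.
  by apply: hclass_tocast; [rewrite i0 add0r | exact: hv].
rewrite scal_neq0 // scale0r; apply: hclass_val0.
by rewrite [LHS]hv scal_neq0 // scale0r.
Qed.

Lemma kunneth_runit (P : cplx k) :
  ccomp (ccomp (hmap (trunit P)) (kunneth P unit_cplx))
    (tmap (cid (hcplx P)) (hunit k))
  = trunit (hcplx P).
Proof.
apply: cmap_ext2 => i j b a; rewrite !ccompE.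
elim/hclass_ind: b => b.
rewrite tmap_pure cidE hunitE kunneth_pure hmapE trunit_pure.
have hv := trunit_pure (erefl (i + j)) (val b) a.
have [j0|j0] := eqVneq j 0.
  by apply: hclass_tocast; [rewrite j0 addr0 | exact: hv].
rewrite scal_neq0 // scale0r; apply: hclass_val0.
by rewrite [LHS]hv scal_neq0 // scale0r.
Qed.

Lemma kunneth_braid (P Q : cplx k) :
  ccomp (hmap (tbraid P Q)) (kunneth P Q)
  = ccomp (kunneth Q P) (tbraid (hcplx P) (hcplx Q)).
Proof.
apply: cmap_ext2 => i j a b; rewrite !ccompE.
elim/hclass_ind: a => a; elim/hclass_ind: b => b.
rewrite kunneth_pure hmapE tbraid_pure cmZ kunneth_pure -hclassZ.
by congr hclass; apply: val_inj; exact: tbraid_pure.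
Qed.

Definition homology : smfunctor (cplx_smcat k) (cplx_smcat k) :=
  @SMFunctor (cplx_smcat k) (cplx_smcat k) (homology_functor_cplx k)
    (@kunneth k) (hunit k) kunneth_nat kunneth_assoc kunneth_lunit
    kunneth_runit kunneth_braid.

Transparent tmap tassoc tbraid tlunit trunit hmap kunneth.
End HomologyFunctor.

Definition quasi_iso k (P Q : cplx k) (f : cmap P Q) : Prop :=
  forall i, bijective (hmap f i).

(* A group morphism from the subgroup [wdom] of K^* to Z, represented by a
   function whose values outside [wdom] are irrelevant. *)
Record weight (K : fieldType) := Weight {
  wdom : {pred K};
  wdom_neq0 : 0 \notin wdom;
  wdom_subgroup : GRing.divr_closed wdom;
  wfun :> K -> int;
  wfunM : {in wdom &, {morph wfun : x y / x * y >-> x + y}}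
}.

Section Purity.
Variables (k : fieldType) (K : closedFieldType) (iota : {rmorphism k -> K}).
Variable w : weight K.

Definition pure_elt (n : int) (x : K) : Prop := x \in wdom w /\ w x = n.

Definition pure_poly (n : int) (p : {poly k}) : Prop :=
  forall x : K, root (map_poly iota p) x -> pure_elt n x.

Definition coordinates (V : lmodType k) m (b : V -> 'rV[k]_m) : Prop :=
  linear b /\ bijective b.

Definition fin_dim (V : lmodType k) : Prop :=
  exists m (b : V -> 'rV[k]_m), coordinates b.

(* A is the matrix of f in some basis of V, acting on row vectors. *)
Definition is_char_poly (V : lmodType k) (f : V -> V) (p : {poly k}) : Prop :=
  exists m (b : V -> 'rV[k]_m) (A : 'M[k]_m),
    [/\ coordinates b, forall v, b (f v) = b v *m A & p = char_poly A].

Definition pure_endo (n : int) (V : lmodType k) (f : V -> V) : Prop :=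
  exists2 p, is_char_poly f p & pure_poly n p.

Definition pure_cmap (n : int) (P : cplx k) (f : cmap P P) : Prop :=
  forall i, pure_endo (n + i) (hmap f i).

Definition finite_type (P : cplx k) : Prop := forall i, fin_dim (P i).

(* For unbounded complexes, the tensor product of two complexes of finite type
   is in general not of finite type. *)
Definition bounded_below (P : cplx k) : Prop :=
  exists m : int, forall i, i < m -> forall x : P i, x = 0.

Definition Cw_ob (X : endo_smcat (cplx_smcat k)) : Prop :=
  [/\ bounded_below (eob X), finite_type (eob X) & pure_cmap 0 (emap X)].

Definition Cw (cl : monoidal_closed Cw_ob) : smcat := full_smcat cl.

Definition Cw_homology (cl : monoidal_closed Cw_ob)
    (stable : forall X, Cw_ob X -> Cw_ob (endo_smfunctor (homology k) X)) :
  smfunctor (Cw cl) (Cw cl) := full_smfunctor cl stable.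

Definition homology_iso (cl : monoidal_closed Cw_ob) (X Y : Cw cl)
    (f : hom X Y) : Prop := quasi_iso (ehom f).
End Purity.

(* Main.v *)
(* Write low_n for the vectors killed by p(f) for some nonzero polynomial p over
   k all of whose roots lie in the domain of w and have weight <= n. The spaces
     T_i(P, f) = (Z_i(P) /\ low_i) + low_(i-1)
   form a subcomplex T(P, f) of P, since the differential sends low_(i-1) in
   degree i into Z_(i-1) /\ low_(i-1). Tensor products of low_m and low_n lie in
   low_(m+n), so T is a symmetric monoidal subfunctor of the identity. As H_i(P)
   is pure of weight i, a cycle of degree i in low_(i-1) is a boundary; hence
   z + y |-> [z] is a well defined monoidal transformation T -> H. Polynomials
   in f prime to those with roots of weight <= i show that T(P, f) -> P is a
   homology isomorphism, and the map to H(P) induces the same map on homology. *)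

Require Import Defs.
From HB Require Import structures.
From mathcomp Require Import all_boot all_order all_algebra.
From mathcomp Require Import boolp zify.
From Stdlib Require Import Relation_Operators.
Set Implicit Arguments.
Unset Strict Implicit.
Unset Printing Implicit Defensive.
Import Order.TTheory GRing.Theory Num.Theory.
Local Open Scope ring_scope.

(** The shape of T comes from canonical truncation. Suppose that P splits into parts of weight n.
    The homology of such a part sits in degree n alone, so the part is linked to its homology by the
    subcomplex made of the cycles in degree n and of everything in degrees above n. Collected by
    degree, weight i contributes its cycles to degree i, and the weights below i contribute
    everything: this is T_i. Bounding weights by i and i - 1 avoids any decomposition. Two further
    facts carry the tensor structure. Weights add up because the eigenvalues of a Kronecker product
    are products of eigenvalues. And P (x) Q is again pure because products of classes span its
    homology, which an explicit homotopy shows. *)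

Lemma linear_fun0 (R : nzRingType) (V W : lmodType R) (f : V -> W) :
  linear f -> f 0 = 0.
Proof.
by move=> lf; rewrite -[X in f X](subrr 0) (zmod_morphism_linear lf) subrr.
Qed.

Lemma linear_funZ (R : nzRingType) (V W : lmodType R) (f : V -> W) a x :
  linear f -> f (a *: x) = a *: f x.
Proof. by move=> lf; rewrite -[a *: x]addr0 lf linear_fun0 // addr0. Qed.

(** * Polynomials in an endomorphism *)

Section PolyAct.
Variable k : fieldType.
Implicit Types p q : {poly k}.

Definition polyact (p : {poly k}) (V : lmodType k) (F : V -> V) (x : V) : V :=
  \sum_(i < size p) p`_i *: iter i F x.

Lemma polyact_widen (V : lmodType k) (F : V -> V) p n x : (size p <= n)%N ->
  polyact p F x = \sum_(i < n) p`_i *: iter i F x.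
Proof.
move=> le; rewrite [LHS](big_ord_widen _ (fun i => p`_i *: iter i F x) le).
rewrite big_mkcond; apply: eq_bigr => i _; case: ltnP => // h.
by rewrite nth_default // scale0r.
Qed.

Lemma polyactD (V : lmodType k) (F : V -> V) p q x :
  polyact (p + q) F x = polyact p F x + polyact q F x.
Proof.
rewrite (@polyact_widen V F p (maxn (size p) (size q))) ?leq_maxl //.
rewrite (@polyact_widen V F q (maxn (size p) (size q))) ?leq_maxr //.
rewrite (polyact_widen _ _ (size_polyD p q)) -big_split /=.
by apply: eq_bigr => i _; rewrite coefD scalerDl.
Qed.

Lemma polyactC (V : lmodType k) (F : V -> V) c x : polyact c%:P F x = c *: x.
Proof.
by rewrite (@polyact_widen V F _ 1) ?size_polyC_leq1 // big_ord1 coefC.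
Qed.

Lemma polyact0 (V : lmodType k) (F : V -> V) x : polyact 0 F x = 0.
Proof. by rewrite -polyC0 polyactC scale0r. Qed.

Lemma polyact1 (V : lmodType k) (F : V -> V) x : polyact 1 F x = x.
Proof. by rewrite -polyC1 polyactC scale1r. Qed.

Lemma polyactMX (V : lmodType k) (F : V -> V) p x :
  polyact (p * 'X) F x = polyact p F (F x).
Proof.
rewrite (@polyact_widen V F _ (size p).+1); last first.
  by rewrite (leq_trans (size_polyMleq _ _)) // size_polyX addn2.
rewrite big_ord_recl /= coefMX eqxx scale0r add0r.
by apply: eq_bigr => i _; rewrite coefMX /= -iterSr.
Qed.

Lemma polyactZ (V : lmodType k) (F : V -> V) a p x :
  polyact (a *: p) F x = a *: polyact p F x.
Proof.
rewrite (@polyact_widen V F _ (size p)) ?size_scale_leq // scaler_sumr.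
by apply: eq_bigr => i _; rewrite coefZ scalerA.
Qed.

Lemma polyactXsubC (V : lmodType k) (F : V -> V) c x :
  polyact ('X - c%:P) F x = F x - c *: x.
Proof.
by rewrite polyactD -['X]mul1r polyactMX polyact1 -polyCN polyactC scaleNr.
Qed.

Lemma polyactN (V : lmodType k) (F : V -> V) p x :
  polyact (- p) F x = - polyact p F x.
Proof. by apply/eqP; rewrite -addr_eq0 -polyactD addNr polyact0. Qed.

(** Carries annihilation by a polynomial along every linear map that intertwines the endomorphisms:
    chain maps, differentials, the inclusion of cycles, the class map, coordinates. *)
Lemma polyact_nat (V W : lmodType k) (phi : V -> W) (F : V -> V) (G : W -> W)
    p x : linear phi -> (forall y, phi (F y) = G (phi y)) ->
  phi (polyact p F x) = polyact p G (phi x).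
Proof.
move=> lphi hF; elim/poly_ind: p x => [|p c IH] x.
  by rewrite !polyact0 linear_fun0.
rewrite !polyactD !polyactMX !polyactC addrC lphi IH hF addrC.
by [].
Qed.

Lemma polyact_linear (V : lmodType k) (F : {linear V -> V}) p :
  linear (polyact p F).
Proof.
move=> a x y; rewrite /polyact scaler_sumr -big_split /=.
apply: eq_bigr => i _; suff -> : iter i F (a *: x + y) = a *: iter i F x + iter i F y.
  by rewrite scalerDr !scalerA mulrC.
by elim: {+}(nat_of_ord i) => //= n ->; rewrite linearP.
Qed.

Lemma polyactM (V : lmodType k) (F : {linear V -> V}) p q x :
  polyact (p * q) F x = polyact p F (polyact q F x).
Proof.
have comm r y : F (polyact r F y) = polyact r F (F y).
  by apply: polyact_nat => //; exact: linearP.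
elim/poly_ind: p x => [|p c IH] x; first by rewrite mul0r !polyact0.
rewrite mulrDl mul_polyC !polyactD polyactZ polyactC -mulrA (mulrC 'X) mulrA.
by rewrite !polyactMX comm IH.
Qed.

Lemma polyactr0 (V : lmodType k) (F : {linear V -> V}) p : polyact p F 0 = 0.
Proof.
exact: linear_fun0 (polyact_linear F p).
Qed.

Lemma polyact_dvd (V : lmodType k) (F : {linear V -> V}) p q x :
  p %| q -> polyact p F x = 0 -> polyact q F x = 0.
Proof. by move=> /dvdpP[r ->] h; rewrite polyactM h polyactr0. Qed.

(** [horner_mx] lives in a nontrivial ring, hence the size [n.+1]; dimension 0 is treated apart
    wherever this is applied. *)
Lemma polyact_mx m n (A : 'M[k]_n.+1) p (u : 'M[k]_(m, n.+1)) :
  polyact p (fun v => v *m A) u = u *m horner_mx A p.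
Proof.
elim/poly_ind: p u => [|p c IH] u; first by rewrite polyact0 rmorph0 mulmx0.
rewrite polyactD polyactMX polyactC IH rmorphD rmorphM /= horner_mx_X.
rewrite horner_mx_C mulmxDr mul_mx_scalar -mulmxA; congr (_ + _).
congr (u *m _); exact: (comm_mx_horner p (erefl : comm_mx A A)).
Qed.

(** The [e i] may be linearly dependent: the map [phi] from row vectors that sends the standard
    basis to [e] intertwines A with F, and Cayley-Hamilton is applied to row vectors. *)
Lemma polyact_char_poly (V : lmodType k) (F : {linear V -> V}) n (e : 'I_n -> V)
    (A : 'M[k]_n) i : (forall i, F (e i) = \sum_j A i j *: e j) ->
  polyact (char_poly A) F (e i) = 0.
Proof.
case: n e A i => [|n] e A i; first by case: i.
move=> hF; pose phi (u : 'rV[k]_n.+1) := \sum_j u 0 j *: e j.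
have lphi : linear phi.
  move=> a u v; rewrite /phi scaler_sumr -big_split; apply: eq_bigr => j _ /=.
  by rewrite !mxE scalerDl scalerA.
have nphi u : phi (u *m A) = F (phi u).
  rewrite /phi linear_sum /=.
  under [in RHS]eq_bigr => j _ do rewrite linearZ /= hF scaler_sumr.
  rewrite exchange_big /=; apply: eq_bigr => j _; rewrite mxE scaler_suml.
  by apply: eq_bigr => l _; rewrite scalerA.
have -> : e i = phi (delta_mx 0 i).
  rewrite /phi (bigD1 i) //= mxE !eqxx scale1r big1 ?addr0 // => j ji.
  by rewrite mxE eqxx (negPf ji) scale0r.
rewrite -(polyact_nat (F := fun v => v *m A)) // polyact_mx Cayley_Hamilton mulmx0.
exact: linear_fun0.
Qed.

End PolyAct.

(** * Eigenvalues of Kronecker products *)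

(** Linear factors of p are peeled off one by one: either u is an eigenvector for z, or
    [F u - z *: u] is nonzero, stays in D and is killed by the remaining factors. Taking for D an
    eigenspace of a second operator yields a common eigenvector. *)
Lemma eigenvector_in (K : closedFieldType) (V : lmodType K) (D : V -> Prop)
    (F : {linear V -> V}) (p : {poly K}) u :
  (forall c x, D x -> D (F x - c *: x)) -> p != 0 ->
  polyact p F u = 0 -> D u -> u != 0 ->
  exists2 x, root p x & exists2 v, D v /\ v != 0 & F v = x *: v.
Proof.
move=> hD p0; have [r dp] := closed_field_poly_normal p.
have c0 : lead_coef p != 0 by rewrite lead_coef_eq0.
have hr x : x \in r -> root p x by rewrite dp rootZ // root_prod_XsubC.
have -> : polyact p F u = 0 <-> polyact (\prod_(z <- r) ('X - z%:P)) F u = 0.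
  rewrite {1}dp polyactZ; split=> [/eqP|->]; last by rewrite scaler0.
  by rewrite scaler_eq0 (negPf c0) => /eqP.
elim: r hr {dp} u => [|z r IH] hr u; rewrite ?big_nil ?big_cons.
  by rewrite polyact1 => -> _; rewrite eqxx.
rewrite mulrC polyactM polyactXsubC => h Du u0.
have [e|ne] := eqVneq (F u - z *: u) 0.
  exists z; first by apply: hr; rewrite mem_head.
  by exists u => //; apply/eqP; rewrite -subr_eq0 e.
apply: (IH _ (F u - z *: u)) => //; last exact: hD.
by move=> x xr; apply: hr; rewrite in_cons xr orbT.
Qed.

(* Acting on m x n matrices U by A^T U B makes [kronmx] the Kronecker product. *)
Definition kronmx (R : comNzRingType) m n (A : 'M[R]_m) (B : 'M[R]_n) :=
  lin_mx (mulmxr B \o mulmx A^T).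

Lemma kronmxE (R : comNzRingType) m n (A : 'M[R]_m) (B : 'M[R]_n) i i' j j' :
  kronmx A B (mxvec_index i j) (mxvec_index i' j') = A i i' * B j j'.
Proof.
have -> : kronmx A B (mxvec_index i j) (mxvec_index i' j') =
    ((delta_mx 0 (mxvec_index i j) : 'rV_(m * n)) *m kronmx A B) 0 (mxvec_index i' j').
  by rewrite -rowE [RHS]mxE.
rewrite -mxvec_delta mul_vec_lin mxvecE /= mxE (bigD1 j) //= big1 ?addr0.
  rewrite mxE (bigD1 i) //= big1 ?addr0; first by rewrite !mxE !eqxx mulr1.
  by move=> l li; rewrite !mxE (negPf li) mulr0.
move=> l lj; rewrite !mxE big1 ?mul0r // => l' _.
by rewrite !mxE (negPf lj) andbF mulr0.
Qed.

(** An eigenvector is a matrix u with A^T u B = z u. The space of such matrices is stable under A^T,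
    so it contains some v with A^T v = x v, v nonzero. As x is nonzero, v B = (z / x) v, and any
    nonzero row of v is an eigenvector of B. *)
Lemma root_kronmx (K : closedFieldType) m n (A : 'M[K]_m) (B : 'M[K]_n) z :
  (forall x, root (char_poly A) x -> x != 0) ->
  root (char_poly (kronmx A B)) z ->
  exists x y, [/\ root (char_poly A) x, root (char_poly B) y & z = x * y].
Proof.
case: m A => [|m] A hA; rewrite -eigenvalue_root_char => /eigenvalueP[w hw w0].
  by case/eqP: w0; exact: thinmx0.
pose u := vec_mx w.
have u0 : u != 0 by apply: contraNneq w0 => e; rewrite -[w]vec_mxK -/u e linear0.
have hu : A^T *m u *m B = z *: u.
  by rewrite -[LHS]/((mulmxr B \o mulmx A^T) u) -mx_rV_lin -/(kronmx A B) hw linearZ.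
pose D (U : 'M[K]_(m.+1, n)) := A^T *m U *m B = z *: U.
have [] := @eigenvector_in K _ D (mulmx A^T) (char_poly A) u.
- move=> c x; rewrite /D => dx; rewrite mulmxBr mulmxBl scalerBr.
  by rewrite -(mulmxA A^T) dx -!scalemxAr -scalemxAl dx !scalerA mulrC.
- exact/monic_neq0/char_poly_monic.
- apply: (can_inj trmxK).
  rewrite (polyact_nat (phi := trmx) (G := fun v => v *m A)).
  + by rewrite polyact_mx Cayley_Hamilton mulmx0 trmx0.
  + exact: linearP.
  + by move=> y; rewrite trmx_mul trmxK.
- exact: hu.
- exact: u0.
move=> x rx [v [Dv v0] hv]; exists x, (z / x).
have x0 := hA _ rx; split=> //; last by rewrite mulrC divfK.
rewrite -eigenvalue_root_char.
have [i vi] : exists i, row i v != 0.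
  apply/existsP; rewrite -negb_forall; apply: contra v0 => /forallP h.
  by apply/eqP/row_matrixP => i; rewrite row0; apply/eqP.
apply/eigenvalueP; exists (row i v) => //.
have hB : v *m B = (z / x) *: v.
  by rewrite mulrC -scalerA -Dv hv -scalemxAl scalerA mulVf // scale1r.
by rewrite -row_mul hB linearZ.
Qed.

(** * Vectors killed by a polynomial with prescribed roots *)

Section RootsIn.
Variables (k : fieldType) (K : closedFieldType) (iota : {rmorphism k -> K}).
Implicit Types (S : K -> Prop) (p q : {poly k}).

Definition roots_in S p : Prop :=
  p != 0 /\ forall x, root (map_poly iota p) x -> S x.

Lemma roots_in1 S : roots_in S 1.
Proof. by split=> [|x]; rewrite ?oner_neq0 // rmorph1 (negPf (root1 _)). Qed.

Lemma roots_inM S p q : roots_in S p -> roots_in S q -> roots_in S (p * q).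
Proof.
move=> [p0 hp] [q0 hq]; split=> [|x]; first by rewrite mulf_neq0.
by rewrite rmorphM rootM => /orP[/hp|/hq].
Qed.

Lemma roots_in_exp S p n : roots_in S p -> roots_in S (p ^+ n).
Proof.
move=> hp; elim: n => [|n IH]; first exact: roots_in1.
by rewrite exprS; exact: roots_inM.
Qed.

Lemma roots_in_sub S S' p : (forall x, S x -> S' x) ->
  roots_in S p -> roots_in S' p.
Proof. by move=> h [p0 hp]; split=> // x /hp/h. Qed.

Lemma roots_in_coprime S S' p q : (forall x, S x -> S' x -> False) ->
  roots_in S p -> roots_in S' q -> coprimep p q.
Proof.
move=> dis [p0 hp] [q0 hq]; rewrite -(coprimep_map iota) coprimep_def.
apply/negPn/closed_rootP => -[x]; rewrite root_gcd => /andP[/hp h /hq h'].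
exact: (dis x).
Qed.

(** Gcds with q are divided out of p until the rest is prime to q. This isolates the part of p whose
    roots are roots of q, without factoring over k. *)
Lemma coprime_split p q : p != 0 -> q != 0 ->
  exists p1 p2 n, [/\ p = p1 * p2, coprimep p2 q & p1 %| q ^+ n].
Proof.
move=> + q0; elim: {p}(size p) {-2}p (leqnn (size p)) => [|s IH] p sp p0.
  by rewrite leqn0 size_poly_eq0 (negPf p0) in sp.
have [cop|ncop] := boolP (coprimep p q).
  by exists 1, p, 0; rewrite mul1r dvdpp.
have [p' dp] := dvdpP _ _ (dvdp_gcdl p q).
have p'0 : p' != 0 by apply: contraNneq p0 => e; rewrite dp e mul0r.
have g0 : gcdp p q != 0 by rewrite gcdp_eq0 (negPf p0).
have [|p1 [p2 [n [e1 e2 e3]]]] := IH p' _ p'0.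
  rewrite -ltnS (leq_trans _ sp) // [in X in (_ < X)%N]dp size_mul //.
  move: ncop; rewrite coprimep_def -(prednK (n := size (gcdp p q))) ?size_poly_gt0 //.
  by case: (_.-1) => [|c] // _; rewrite addnS /= addnS ltnS leq_addr.
exists (gcdp p q * p1), p2, n.+1; split=> //.
  by rewrite -mulrA -e1 mulrC.
by rewrite exprS dvdp_mul ?dvdp_gcdr.
Qed.

(** One notion with two uses: for S the elements of weight n it expresses purity on homology, for S
    those of weight at most n it cuts out the truncation. The polynomial may depend on the
    vector. *)
Definition killed S (V : lmodType k) (F : V -> V) (x : V) : Prop :=
  exists2 p, roots_in S p & polyact p F x = 0.

Lemma killed0 S (V : lmodType k) (F : {linear V -> V}) : killed S F 0.
Proof. by exists 1; [exact: roots_in1 | rewrite polyactr0]. Qed.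

Lemma killedP S (V : lmodType k) (F : {linear V -> V}) a x y :
  killed S F x -> killed S F y -> killed S F (a *: x + y).
Proof.
move=> [p hp px] [q hq qy]; exists (p * q); first exact: roots_inM.
rewrite polyact_linear (polyact_dvd (dvdp_mulr q (dvdpp p)) px).
by rewrite (polyact_dvd (dvdp_mull p (dvdpp q)) qy) scaler0 addr0.
Qed.

Lemma killedD S (V : lmodType k) (F : {linear V -> V}) x y :
  killed S F x -> killed S F y -> killed S F (x + y).
Proof. by move=> hx hy; rewrite -[x]scale1r; exact: killedP. Qed.

Lemma killed_sub S S' (V : lmodType k) (F : V -> V) x :
  (forall z, S z -> S' z) -> killed S F x -> killed S' F x.
Proof. by move=> h [p hp px]; exists p => //; exact: roots_in_sub hp. Qed.

Lemma killed_nat S (V W : lmodType k) (phi : V -> W) (F : V -> V) (G : W -> W) x :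
  linear phi -> (forall y, phi (F y) = G (phi y)) ->
  killed S F x -> killed S G (phi x).
Proof.
move=> lphi h [p hp px]; exists p => //.
by rewrite -(polyact_nat (F := F)) // px linear_fun0.
Qed.

Lemma killed_inj S (V W : lmodType k) (phi : V -> W) (F : V -> V) (G : W -> W) x :
  linear phi -> injective phi -> (forall y, phi (F y) = G (phi y)) ->
  killed S G (phi x) -> killed S F x.
Proof.
move=> lphi iphi h [p hp px]; exists p => //; apply: iphi.
by rewrite (polyact_nat (G := G)) // px linear_fun0.
Qed.

Lemma killed_disjoint S S' (V : lmodType k) (F : {linear V -> V}) x :
  (forall z, S z -> S' z -> False) -> killed S F x -> killed S' F x -> x = 0.
Proof.
move=> dis [p hp px] [q hq qx].
have /Bezout_eq1_coprimepP[[u v] /= e] := roots_in_coprime dis hp hq.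
rewrite -[x](polyact1 F) -e polyactD (polyact_dvd (dvdp_mull u (dvdpp p)) px).
by rewrite (polyact_dvd (dvdp_mull v (dvdpp q)) qx) addr0.
Qed.

(** On the iterates x, F x, ..., F^(d-1) x with d = deg p, F is a shift, except that the monic
    relation p(F) x = 0 folds F^d x back; these are the rows of the companion matrix. *)
Lemma companion_act (V : lmodType k) (F : V -> V) p x i :
  p \is monic -> polyact p F x = 0 ->
  F (iter (i : 'I_(size p).-1) F x)
  = \sum_j companionmx p i j *: iter j F x.
Proof.
move=> mp.
have [li|li] := eqVneq (nat_of_ord i) (size p).-1.-1.
  rewrite (@polyact_widen k V F p (size p).-1.+1) ?leqSpred // big_ord_recr /=.
  rewrite -lead_coefE (monicP mp) scale1r => /eqP; rewrite addrC addr_eq0 => /eqP.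
  rewrite -iterS; have -> : i.+1 = (size p).-1.
    by rewrite li prednK // (leq_ltn_trans _ (ltn_ord i)).
  move=> ->; rewrite -sumrN; apply: eq_bigr => j _.
  by rewrite mxE li eqxx scaleNr.
move=> _; have hi : (i.+1 < (size p).-1)%N.
  rewrite ltn_neqAle (ltn_ord i) andbT; apply: contra li => /eqP e.
  by apply/eqP; rewrite -[LHS]/(i.+1.-1) e.
rewrite (bigD1 (Ordinal hi)) //= mxE (negPf li) eqxx scale1r big1 ?addr0 // => j ji.
rewrite mxE (negPf li); case: eqP => [e|_]; last by rewrite scale0r.
by case/eqP: ji; apply: val_inj.
Qed.

(* The polynomial that kills B x y is the characteristic polynomial of the
   Kronecker product of the companion matrices of those that kill x and y. *)
Lemma killed_bilinear S1 S2 S (V1 V2 V : lmodType k) (F1 : {linear V1 -> V1})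
    (F2 : {linear V2 -> V2}) (F : {linear V -> V}) (B : V1 -> V2 -> V) x y :
  (forall y, linear (B^~ y)) -> (forall x, linear (B x)) ->
  (forall x y, F (B x y) = B (F1 x) (F2 y)) ->
  (forall z, S1 z -> z != 0) -> (forall z t, S1 z -> S2 t -> S (z * t)) ->
  killed S1 F1 x -> killed S2 F2 y -> killed S F (B x y).
Proof.
move=> ll lr hB S10 hS.
have monic_killed S0 (W : lmodType k) (G : W -> W) v : killed S0 G v ->
    exists p, [/\ p \is monic, forall z, root (map_poly iota p) z -> S0 z
             & polyact p G v = 0].
  case=> p [p0 hp] pv; have l0 : lead_coef p != 0 by rewrite lead_coef_eq0.
  exists ((lead_coef p)^-1 *: p); split.
  - by rewrite monicE lead_coefZ mulVf.
  - by move=> z; rewrite map_polyZ rootZ ?fmorph_eq0 ?invr_eq0 // => /hp.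
  - by rewrite polyactZ pv scaler0.
case/monic_killed => p [mp hp px]; case/monic_killed => q [mq hq qy].
have p0 := monic_neq0 mp; have q0 := monic_neq0 mq.
pose A := companionmx p; pose C := companionmx q.
exists (char_poly (kronmx A C)).
  split=> [|z]; first exact/monic_neq0/char_poly_monic.
  rewrite map_char_poly /kronmx
    (map_lin_mx _ (gf := mulmxr (map_mx iota C) \o mulmx (map_mx iota A)^T)); last first.
    by move=> U; rewrite /= !map_mxM map_trmx.
  have hA t : root (char_poly (map_mx iota A)) t -> S1 t.
    by rewrite -map_char_poly companionmxK // => /hp.
  case/root_kronmx => [t /hA/S10 //|t [u [/hA ht + ->]]].
  by rewrite -map_char_poly companionmxK // => /hq; exact: hS.
(* For p = 1 the companion matrix has size 0 and leaves no index for x itself; but then x = 0. The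
   same goes for q and y. *)
have [sp|sp] := leqP (size p) 1.
  have e : p = 1.
    by move: (mp); rewrite (size1_polyC sp) monicE lead_coefC => /eqP ->.
  have -> : x = 0 by rewrite -(polyact1 F1 x) -e.
  by rewrite (linear_fun0 (ll y)) polyactr0.
have [sq|sq] := leqP (size q) 1.
  have e : q = 1.
    by move: (mq); rewrite (size1_polyC sq) monicE lead_coefC => /eqP ->.
  have -> : y = 0 by rewrite -(polyact1 F2 y) -e.
  by rewrite (linear_fun0 (lr x)) polyactr0.
have sp' : (0 < (size p).-1)%N by rewrite -ltnS prednK // ltnW.
have sq' : (0 < (size q).-1)%N by rewrite -ltnS prednK // ltnW.
(* The family B (F1^i x) (F2^j y), listed in the order of the Kronecker product: the index l is
   decoded by inverting [mxvec_index]. Its member at (0, 0) is B x y. *)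
pose e (l : 'I_((size p).-1 * (size q).-1)) :=
  let ij := enum_val (cast_ord (esym (mxvec_cast _ _)) l) in
  B (iter ij.1 F1 x) (iter ij.2 F2 y).
have eE i j : e (mxvec_index i j) = B (iter i F1 x) (iter j F2 y).
  by rewrite /e cast_ordK enum_rankK.
rewrite -[B x y]/(B (iter (Ordinal sp') F1 x) (iter (Ordinal sq') F2 y)) -eE.
apply: polyact_char_poly => l; case/mxvec_indexP: l => i j.
rewrite eE hB (companion_act _ mp px) (companion_act _ mq qy).
rewrite (reindex _ (curry_mxvec_bij _ _)) /=.
transitivity (\sum_i' \sum_j' kronmx A C (mxvec_index i j) (mxvec_index i' j')
  *: e (mxvec_index i' j')); last by rewrite pair_bigA; apply: eq_bigr => -[].
have lE (W W' : lmodType k) (f : W -> W') (I : finType) (c : I -> k) (w : I -> W) :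
    linear f -> f (\sum_i c i *: w i) = \sum_i c i *: f (w i).
  move=> lf; elim/big_rec2: _ => [|l u v _ <-]; first exact: linear_fun0.
  exact: lf.
rewrite (lE _ _ (B^~ _)) //; apply: eq_bigr => i' _; rewrite lE // scaler_sumr.
by apply: eq_bigr => j' _; rewrite kronmxE eE scalerA.
Qed.

End RootsIn.

(** * Finite dimensional spaces *)

Section FiniteDimension.
Variable k : fieldType.
Implicit Types U V W : lmodType k.

Lemma coordinates_inv V m (b : V -> 'rV[k]_m) : coordinates b ->
  exists g : 'rV[k]_m -> V, [/\ linear g, cancel b g & cancel g b].
Proof.
case=> lb [g bK gK]; exists g; split=> // a u v.
by apply: (can_inj bK); rewrite lb !gK.
Qed.

Lemma fin_dim_bij V m (g : 'rV[k]_m -> V) :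
  linear g -> injective g -> (forall v, exists u, g u = v) -> fin_dim V.
Proof.
move=> lg ig sg; have [b hb] := choice sg.
exists m, b; split; last by exists g => // u; apply: ig; rewrite hb.
by move=> a x y; apply: ig; rewrite lg !hb.
Qed.

Lemma fin_dim_surj V m (g : 'rV[k]_m -> V) :
  linear g -> (forall v, exists u, g u = v) -> fin_dim V.
Proof.
elim: m g => [|m IH] g lg sg.
  by apply: (fin_dim_bij lg) => // u v _; rewrite !thinmx0 // ; exact: thinmx0.
have [ig|] := pselect (injective g); first exact: fin_dim_bij sg.
move=> nig; have [u u0 gu] : exists2 u, u != 0 & g u = 0.
  apply: contrapT => h; apply: nig => x y e; apply/eqP; rewrite -subr_eq0.
  apply/negPn/negP => xy; apply: h; exists (x - y) => //.
  by rewrite (zmod_morphism_linear lg) e subrr.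
have [j uj] : exists j, u 0 j != 0.
  apply/existsP; rewrite -negb_forall; apply: contra u0 => /forallP h.
  by apply/eqP/rowP => j; rewrite mxE; apply/eqP.
(* Inserts the entry 0 at place j. *)
pose s (c : 'rV[k]_m) : 'rV[k]_m.+1 := \row_i oapp (c 0) 0 (unlift j i).
apply: (IH (g \o s)) => [a x y|v] /=.
  rewrite -lg; congr g; apply/rowP => i; rewrite !mxE.
  by case: unliftP => [l|] _ /=; rewrite ?mxE ?mulr0 ?addr0.
have [x <-] := sg v.
exists (\row_l (x - (x 0 j / u 0 j) *: u) 0 (lift j l)).
transitivity (g (x - (x 0 j / u 0 j) *: u)); last first.
  by rewrite (zmod_morphism_linear lg) linear_funZ // gu scaler0 subr0.
congr g; apply/rowP => i; rewrite !mxE; case: unliftP => [l ->|->] /=.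
  by rewrite !mxE.
by rewrite divfK // subrr.
Qed.

Lemma fin_dim_quot V W (g : V -> W) :
  linear g -> (forall w, exists v, g v = w) -> fin_dim V -> fin_dim W.
Proof.
move=> lg sg [m [b /coordinates_inv[b' [lb' bK _]]]].
apply: (@fin_dim_surj W m (g \o b')) => [a x y|w] /=; first by rewrite lb' lg.
by have [v <-] := sg w; exists (b v); rewrite /= bK.
Qed.

(** Take a family of r vectors with independent images, r maximal; r is at most m. A vector whose
    image escapes their span would extend the family, so the family spans V. *)
Lemma fin_dim_sub V W (g : V -> W) :
  linear g -> injective g -> fin_dim W -> fin_dim V.
Proof.
move=> lg ig [m [b [lb /bij_inj ib]]].
pose f v := b (g v).
have lf : linear f by move=> a x y; rewrite /f lg lb.
have inf : injective f by move=> x y /ib/ig.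
pose D r := `[< exists v : 'I_r -> V, row_free (\matrix_i f (v i)) >].
have D0 : exists r, D r.
  by exists 0; apply/asboolP; exists (fun=> 0); rewrite /row_free flatmx0 mxrank0.
have Dle r : D r -> (r <= m)%N.
  by move=> /asboolP[v /eqP <-]; exact: rank_leq_col.
case: (ex_maxnP D0 Dle) => r /asboolP[v fv] mr.
have fE (c : 'rV_r) : f (\sum_i c 0 i *: v i) = c *m \matrix_i f (v i).
  rewrite mulmx_sum_row; elim/big_rec2: _ => [|i x y _ <-]; first exact: linear_fun0.
  by rewrite rowK lf.
apply: (@fin_dim_surj V r (fun c => \sum_i c 0 i *: v i)).
  move=> a x y; rewrite scaler_sumr -big_split; apply: eq_bigr => i _ /=.
  by rewrite !mxE scalerDl scalerA.
move=> x; suff /submxP[c hc] : (f x <= \matrix_i f (v i))%MS.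
  by exists c; apply: inf; rewrite fE.
apply/negPn/negP => nx; suff /mr : D (r + 1)%N by rewrite addn1 ltnn.
apply/asboolP.
exists (fun i => match split i with inl j => v j | inr _ => x end).
have -> : \matrix_i f (match split i with inl j => v j | inr _ => x end)
    = col_mx (\matrix_i f (v i)) (f x).
  apply/matrixP => i j; rewrite !mxE; case: split => l; rewrite ?mxE //.
  by rewrite ord1.
rewrite /row_free -addsmxE mxrank_disjoint_sum.
  by rewrite (eqP fv) rank_rV (_ : f x != 0) //; apply: contraNneq nx => ->; rewrite sub0mx.
apply/eqP; rewrite -mxrank_eq0; apply: contraR nx => h.
have : (\rank (f x) <= \rank ((\matrix_i f (v i)) :&: f x)%MS)%N.
  by rewrite rank_rV (leq_trans (leq_b1 _)) // lt0n.
rewrite (geq_leqif (mxrank_leqif_sup (capmxSr _ _))) => hx.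
exact: submx_trans hx (capmxSl _ _).
Qed.

(** Spanning is phrased as an induction principle rather than by coefficients, which combines
    directly with [gtens_ind] for tensor products. *)
Definition generates V (s : seq V) : Prop :=
  forall D : V -> Prop, D 0 -> (forall a x y, D x -> D y -> D (a *: x + y)) ->
    (forall x, x \in s -> D x) -> forall x, D x.

Lemma fin_dim_gen V : fin_dim V <-> exists s : seq V, generates s.
Proof.
split.
  case=> m [b /coordinates_inv[g [lg bK gK]]].
  exists [seq g (delta_mx 0 i) | i <- enum 'I_m] => D D0 DP Ds x.
  rewrite -[x]bK [b x]row_sum_delta; elim/big_rec: _ => [|i v _ Dv].
    by rewrite linear_fun0.
  by rewrite lg; apply: DP => //; apply/Ds/map_f; rewrite mem_enum.
case=> s hs; apply: (@fin_dim_surj V (size s) (fun c => \sum_i c 0 i *: s`_i)).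
  move=> a x y; rewrite scaler_sumr -big_split; apply: eq_bigr => i _ /=.
  by rewrite !mxE scalerDl scalerA.
apply: hs => [|a x y [c <-] [d <-]|x xs].
- by exists 0; rewrite big1 // => i _; rewrite mxE scale0r.
- exists (a *: c + d); rewrite scaler_sumr -big_split; apply: eq_bigr => i _ /=.
  by rewrite !mxE scalerDl scalerA.
- have hi : (index x s < size s)%N by rewrite index_mem.
  exists (delta_mx 0 (Ordinal hi)); rewrite (bigD1 (Ordinal hi)) //= mxE !eqxx.
  rewrite scale1r nth_index // big1 ?addr0 // => i ne.
  by rewrite mxE eqxx (negPf ne) scale0r.
Qed.

Lemma mx_of_endo V m (b : V -> 'rV[k]_m) (F : {linear V -> V}) :
  coordinates b -> exists A : 'M[k]_m, forall v, b (F v) = b v *m A.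
Proof.
move=> cb; have [g [lg bK gK]] := coordinates_inv cb.
have [lb _] := cb; exists (\matrix_i b (F (g (delta_mx 0 i)))) => v.
have lf : linear (fun u => b (F (g u))) by move=> a x y; rewrite lg linearP lb.
rewrite mulmx_sum_row -{1}[v]bK [b v in LHS]row_sum_delta.
elim/big_rec2: _ => [|i x y _ <-]; first exact: (linear_fun0 lf).
by rewrite rowK lf.
Qed.

Lemma fin_dim_killed V (F : {linear V -> V}) : fin_dim V ->
  exists2 p : {poly k}, p != 0 & forall x, polyact p F x = 0.
Proof.
case=> m [b cb]; have [A hA] := mx_of_endo F cb.
exists (char_poly A) => [|x]; first exact/monic_neq0/char_poly_monic.
have [g [lg bK gK]] := coordinates_inv cb; have [lb _] := cb.
apply: (can_inj bK); rewrite (polyact_nat (G := fun v => v *m A)) // linear_fun0 //.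
case: m b cb A hA g lg bK gK lb => [|m] b cb A hA g lg bK gK lb; first exact: thinmx0.
by rewrite polyact_mx Cayley_Hamilton mulmx0.
Qed.

(** A generalized inverse, given in coordinates by [pinvmx]. For a differential it stands in for a
    choice of complements of cycles and boundaries. *)
Lemma linear_pinv V W (d : V -> W) : linear d -> fin_dim V -> fin_dim W ->
  exists2 h : W -> V, linear h & forall x, d (h (d x)) = d x.
Proof.
move=> ld [m [b cb]] [n [c cc]].
have [b' [lb' bK b'K]] := coordinates_inv cb; have [lb _] := cb.
have [c' [lc' cK c'K]] := coordinates_inv cc; have [lc _] := cc.
pose D := \matrix_i c (d (b' (delta_mx 0 i))).
have dE x : c (d x) = b x *m D.
  rewrite mulmx_sum_row -{1}[x]bK [b x in LHS]row_sum_delta.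
  have lf : linear (fun u => c (d (b' u))) by move=> r u v; rewrite lb' ld lc.
  elim/big_rec2: _ => [|i u v _ <-]; first exact: (linear_fun0 lf).
  by rewrite rowK lf.
exists (fun y => b' (c y *m pinvmx D)).
  by move=> a x y; rewrite lc mulmxDl -scalemxAl lb'.
move=> x; apply: (can_inj cK); rewrite !dE b'K.
by rewrite -(mulmxA (b x) D) -(mulmxA (b x)) mulmxKpV.
Qed.

Lemma gtens_fin_dim (P Q : int -> lmodType k) (lP lQ n : int) :
  (forall i, i < lP -> forall x : P i, x = 0) ->
  (forall i, i < lQ -> forall x : Q i, x = 0) ->
  (forall i, fin_dim (P i)) -> (forall i, fin_dim (Q i)) ->
  fin_dim (gtens P Q n : lmodType k).
Proof.
move=> bP bQ fP fQ; apply/fin_dim_gen.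
have gP i := cid ((fin_dim_gen (P i)).1 (fP i)).
have gQ i := cid ((fin_dim_gen (Q i)).1 (fQ i)).
have e i : i + (n - i) = n by rewrite addrC subrK.
(* Nonzero symbols have lP <= i <= n - lQ, so i = lP + l with l below n - lQ - lP + 1. If that
   number is negative, its absolute value only adds harmless generators. *)
exists (flatten [seq [seq pure_tens (e (lP + l%:Z)) x y | x <- sval (gP _), y <- sval (gQ _)]
  | l <- iota 0 (absz (n - lQ - lP + 1)%R)]) => D D0 DP Ds.
have DD x y : D x -> D y -> D (x + y) by move=> hx; rewrite -[x]scale1r; exact: DP.
elim/gtens_ind => // i j eij x y.
have [iP|iP] := ltP i lP; first by rewrite (bP i iP x) pure0l.
have [jQ|jQ] := ltP j lQ; first by rewrite (bQ j jQ y) pure0r.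
have ej : n - i = j by rewrite -eij addrAC subrr add0r.
case: _ / ej eij y jQ => eij y jQ.
move: y; apply: (svalP (gQ (n - i))) => [|a y y' Dy Dy'|y yQ].
- by rewrite pure0r.
- by rewrite pureDr pureZr; exact: DP.
move: x; apply: (svalP (gP i)) => [|a x x' Dx Dx'|x xP].
- by rewrite pure0l.
- by rewrite pureDl pureZl; exact: DP.
have [l dl] : exists l : nat, i - lP = l%:Z.
  by exists (absz (i - lP)%R); rewrite gez0_abs // subr_ge0.
have ei : i = lP + l%:Z by rewrite -dl addrC subrK.
case: _ / (esym ei) eij x xP y yQ iP jQ dl => eij x xP y yQ iP jQ dl.
apply: Ds; apply/flattenP.
exists [seq pure_tens (e (lP + l%:Z)) x y | x <- sval (gP _), y <- sval (gQ _)].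
  apply/mapP; exists l => //; rewrite mem_iota add0n /=.
  rewrite -ltz_nat gez0_abs; lia.
by rewrite (pure_irr _ (e _)); apply: allpairs_f.
Qed.

End FiniteDimension.

(** * Surjectivity of the Kuenneth morphism *)

Section Homotopy.
Variables (k : fieldType) (P : cplx k).

Definition splitting (h : forall i j, j = i + 1 -> P i -> P j) : Prop :=
  (forall i j (e : j = i + 1), linear (h i j e)) /\
  (forall i j (e : j = i + 1) x, diff e (h i j e (diff e x)) = diff e x).

Lemma splitting_exists : finite_type P -> exists h, splitting h.
Proof.
move=> fP; have H i j (e : j = i + 1) := cid2 (linear_pinv (diff_linear e) (fP j) (fP i)).
exists (fun i j e => s2val (H i j e)); split=> i j e; first exact: (s2valP (H i j e)).
exact: (s2valP' (H i j e)).
Qed.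

Variable h : forall i j, j = i + 1 -> P i -> P j.
Hypothesis hh : splitting h.

(* With d h d = d, the map 1 - d h - h d takes values in cycles, kills boundaries
   and is homotopic to the identity. *)
Definition hproj i (x : P i) : P i :=
  x - diff erefl (h erefl x) - h (pred_deg i) (diff (pred_deg i) x).

Lemma hprojE i (x : P i) :
  hproj x = x - diff erefl (h erefl x) - h (pred_deg i) (diff (pred_deg i) x).
Proof. by []. Qed.

Lemma hproj_linear i : linear (@hproj i).
Proof.
move=> a x y; rewrite /hproj hh.1 !diffD !diffZ hh.1 !scalerBr !opprD -!scalerN.
by rewrite (addrACA (a *: x) y) [LHS]addrACA.
Qed.

Lemma diff_hproj i j (e : i = j + 1) (x : P i) : diff e (hproj x) = 0.
Proof.
have ej : i - 1 = j by rewrite e addrK.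
case: _ / ej e => e; rewrite (Prop_irrelevance e (pred_deg i)).
by rewrite /hproj !linearB /= diff_diff hh.2 subr0 subrr.
Qed.

Lemma hproj_diff i j (e : i = j + 1) (x : P i) : hproj (diff e x) = 0.
Proof.
subst i; rewrite /hproj diff_diff hh.2 (linear_fun0 (hh.1 _ _ _)).
by rewrite subrr subr0.
Qed.

Lemma hproj_is_cycle i (x : P i) : hproj x \in is_cycle P i.
Proof. apply/(is_cycleP (pred_deg i)); exact: diff_hproj. Qed.
End Homotopy.

Section KunnethSurjective.
Variables (k : fieldType) (P Q : cplx k).
Variables (h : forall i j, j = i + 1 -> P i -> P j)
          (g : forall i j, j = i + 1 -> Q i -> Q j).
Hypotheses (hh : splitting h) (hg : splitting g).

Lemma deg_succl (i j n m : int) : i + j = n -> m = n + 1 -> i + 1 + j = m.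
Proof. by move=> <- ->; rewrite addrAC. Qed.

Lemma deg_succr (i j n m : int) : i + j = n -> m = n + 1 -> i + (j + 1) = m.
Proof. by move=> <- ->; rewrite addrA. Qed.

Definition hproj2_bifam n : bifam P Q n (gtens P Q n).
Proof.
refine (@Bifam k P Q n (gtens P Q n)
  (fun i j e x y => pure_tens e (hproj h x) (hproj g y)) _ _).
- by move=> i j e y a x x'; rewrite hproj_linear // pureDl pureZl.
- by move=> i j e x a y y'; rewrite hproj_linear // pureDr pureZr.
Defined.

(** The homotopy h (x) 1 + pi (x) g, with pi for [hproj]; the sign [sg i] arises as g, of degree 1,
    passes x. *)
Definition homotopy_bifam n m (e : m = n + 1) : bifam P Q n (gtens P Q m).
Proof.
refine (@Bifam k P Q n (gtens P Q m) (fun i j eij x y =>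
   pure_tens (deg_succl eij e) (h erefl x) y
   + sg i *: pure_tens (deg_succr eij e) (hproj h x) (g erefl y)) _ _).
- move=> i j eij y a x x'.
  rewrite hh.1 hproj_linear // 2!pureDl !pureZl !scalerDr addrACA !scalerA.
  by rewrite mulrC.
- move=> i j eij x a y y'.
  by rewrite hg.1 !pureDr !pureZr !scalerDr addrACA !scalerA mulrC.
Defined.

Lemma pure_splitl n i i' j (e0 : i' = i + 1) (e : i + 1 + j = n) (e' : i' + j = n)
    (x : P i) (y : Q j) :
  pure_tens e (h erefl x) y = pure_tens e' (h e0 x) y.
Proof. by subst i'; exact: pure_irr. Qed.

Lemma pure_splitr n i j j' (e0 : j' = j + 1) (e : i + (j + 1) = n) (e' : i + j' = n)
    (x : P i) (y : Q j) :
  pure_tens e x (g erefl y) = pure_tens e' x (g e0 y).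
Proof. by subst j'; exact: pure_irr. Qed.

(** The terms h x (x) d y cancel by sign, and the mixed terms in pi vanish since pi d = 0 = d pi.
    What remains is (1 - pi) (x) 1 + pi (x) (1 - pi) = 1 - pi (x) pi. *)
Lemma homotopyE n (t : gtens P Q n) :
  diff (c := tcplx P Q) erefl (tlift (homotopy_bifam erefl) t)
  + tlift (homotopy_bifam (pred_deg n)) (diff (c := tcplx P Q) (pred_deg n) t)
  = t - tlift (hproj2_bifam n) t.
Proof.
elim/gtens_ind: t => [|t u ht hu|i j eij x y].
- by rewrite !linear0 !addr0 ?oppr0.
- by rewrite !linearD /= addrACA ht hu addrACA.
rewrite !tlift_pure /= tdiff_pure !linearD !linearZ /= !tlift_pure /=.
have e1 : i + 1 + (j - 1) = n by rewrite addrACA subrr addr0.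
have e2 : i - 1 + (j + 1) = n by rewrite addrACA addNr addr0.
rewrite (tdiff_pureE erefl _ erefl (pred_deg j) eij e1).
rewrite (tdiff_pureE erefl _ (pred_deg i) erefl e2 eij).
rewrite diff_hproj // hproj_diff // !pure0l scaler0 addr0 add0r.
rewrite (pure_splitl (pred_deg i) _ eij) (pure_splitr (pred_deg j) _ eij).
rewrite (pure_irr _ e1) scalerDr !scalerA sgK !scale1r.
rewrite [sg (i + 1)]sgD sg1 mulrN1 scaleNr.
rewrite [hproj g y]hprojE !pureBr [in X in _ = _ - (X - _ - _)]hprojE !pureBl.
have shuffle (V : zmodType) (u v z c s t : V) :
    u - c + s + (v + (c + t)) = z - (z - u - v - s - t).
  rewrite !addrA [LHS](ACl ((1*4*3*6)*(2*5))) /= addNr addr0.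
  by rewrite !opprD !opprK !addrA subrr add0r.
exact: shuffle.
Qed.

(** Surjectivity of the Kuenneth morphism as an induction principle: by the homotopy, a cycle z is
    homologous to (pi (x) pi) z, which is a sum of tensors of cycles. *)
Lemma kunneth_ind n (D : hgr (tcplx P Q) n -> Prop) : D 0 ->
  (forall a b, D a -> D b -> D (a + b)) ->
  (forall i j (e : i + j = n) (a : hgr P i) (b : hgr Q j), D (kunneth_fun e a b)) ->
  forall a, D a.
Proof.
move=> D0 DD Dp; elim/hclass_ind => z.
(* The induction runs over all chains, because the symbols that make up a cycle need not be cycles
   themselves; their images under pi (x) pi are. *)
have [c hc Dc] : exists2 c : Defs.cycle (tcplx P Q) n,
    val c = tlift (hproj2_bifam n) (val z) & D (hclass c).
  elim/gtens_ind: {z}(val z) => [|t u [c hc Dc] [d hd Dd]|i j e x y].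
  - by exists 0; rewrite ?linear0 // -[hclass 0]/(0).
  - exists (c + d).
      rewrite [RHS]linearD; have -> : val (c + d) = val c + val d by [].
      by rewrite hc hd.
    rewrite -[c + d]scale1r scalerDr !scale1r -[c]scale1r hclass_linear scale1r.
    exact: DD.
  - exists (cycle_tens e (Cycle (hproj_is_cycle hh x)) (Cycle (hproj_is_cycle hg y))).
      by rewrite tlift_pure.
    by rewrite -kunneth_class; exact: Dp.
suff -> : hclass z = hclass c by [].
apply/hclass_eqP; exists (tlift (homotopy_bifam erefl) (val z)).
by rewrite hc -homotopyE (is_cycleP (pred_deg n) _ (cvalP z)) linear0 addr0.
Qed.
End KunnethSurjective.

(** * Purity *)

Section Purity.
Variables (k : fieldType) (K : closedFieldType) (iota : {rmorphism k -> K}).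
Variable w : weight K.

Lemma polyact_eigen (V : lmodType K) (F : {linear V -> V}) c v (p : {poly K}) :
  F v = c *: v -> polyact p F v = p.[c] *: v.
Proof.
move=> h; rewrite /polyact horner_coef scaler_suml; apply: eq_bigr => i _.
rewrite -scalerA; congr (_ *: _); elim: {i}(nat_of_ord i) => [|n IH] /=.
  by rewrite scale1r.
by rewrite IH linearZ /= h scalerA exprSr.
Qed.

Lemma killed_uniform S (V : lmodType k) (F : {linear V -> V}) :
  fin_dim V -> (forall v, killed iota S F v) ->
  exists2 p, roots_in iota S p & forall v, polyact p F v = 0.
Proof.
move=> /fin_dim_gen[s gs] h.
have [p hp ps] : exists2 p, roots_in iota S p & forall v, v \in s -> polyact p F v = 0.
  elim: s {gs} => [|x s [p hp ps]]; first by exists 1 => //; exact: roots_in1.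
  have [q hq qx] := h x; exists (p * q); first exact: roots_inM.
  move=> v; rewrite in_cons => /orP[/eqP ->|vs].
    by apply: polyact_dvd qx; exact: dvdp_mull.
  by apply: polyact_dvd (ps _ vs); exact: dvdp_mulr.
exists p => //; apply: gs => [|a x y px py|//]; first exact: polyactr0.
by rewrite polyact_linear px py scaler0 addr0.
Qed.

(** Purity without bases. For the converse, one polynomial p kills all of V, so p(A) = 0 and every
    eigenvalue of A in K is a root of p. *)
Lemma pure_endoP n (V : lmodType k) (F : {linear V -> V}) :
  pure_endo iota w n F <-> fin_dim V /\ forall v, killed iota (pure_elt w n) F v.
Proof.
split=> [[p [m [b [A [cb hA ->]]]] hp]|[fV kV]].
  split=> [|v]; first by exists m, b.
  exists (char_poly A); first by split=> //; exact/monic_neq0/char_poly_monic.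
  have [g [lg bK gK]] := coordinates_inv cb; have [lb _] := cb.
  apply: (can_inj bK); rewrite (polyact_nat (G := fun v => v *m A)) // (linear_fun0 lb).
  case: m b cb A hA hp g lg bK gK lb => [|m] b cb A *; first exact: thinmx0.
  by rewrite polyact_mx Cayley_Hamilton mulmx0.
have [p [p0 hp] pV] := killed_uniform fV kV.
have [m [b cb]] := fV; have [A hA] := mx_of_endo F cb.
exists (char_poly A); first by exists m, b, A.
move=> x; rewrite map_char_poly -eigenvalue_root_char => /eigenvalueP[v hv v0].
apply: hp; have [g [lg bK gK]] := coordinates_inv cb; have [lb _] := cb.
case: m b cb A hA v hv v0 g lg bK gK lb => [|m] b cb A hA v hv v0 g lg bK gK lb.
  by case/eqP: v0; exact: thinmx0.
have pA : horner_mx A p = 0.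
  apply/row_matrixP => i; rewrite row0 rowE -polyact_mx -[delta_mx _ _]gK.
  by rewrite -(polyact_nat (F := F)) // pV linear_fun0.
have : polyact (map_poly iota p) (fun u => u *m map_mx iota A) v = 0.
  by rewrite polyact_mx -map_horner_mx pA map_mx0 mulmx0.
rewrite (@polyact_eigen _ (mulmxr (map_mx iota A)) x) // => /eqP.
by rewrite scaler_eq0 (negPf v0) orbF.
Qed.

Lemma wdomM x y : x \in wdom w -> y \in wdom w -> x * y \in wdom w.
Proof. exact: (GRing.divr_closedM (wdom_subgroup w)).2. Qed.

Lemma wdom1 : 1 \in wdom w.
Proof. exact: (wdom_subgroup w).1. Qed.

Lemma wfun1 : w 1 = 0.
Proof.
have := wfunM wdom1 wdom1; rewrite mulr1 => /eqP.
by rewrite eq_sym -subr_eq0 addrK => /eqP.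
Qed.

Lemma pure_elt1 : pure_elt w 0 1. Proof. by split; [exact: wdom1 | exact: wfun1]. Qed.

Lemma pure_elt_neq0 n x : pure_elt w n x -> x != 0.
Proof. by case=> xd _; apply: contraNneq (wdom_neq0 w) => <-. Qed.

Lemma pure_eltM m n x y :
  pure_elt w m x -> pure_elt w n y -> pure_elt w (m + n) (x * y).
Proof. by move=> [xd <-] [yd <-]; split; [exact: wdomM | exact: wfunM]. Qed.

Definition low_elt (n : int) (x : K) : Prop := x \in wdom w /\ w x <= n.

Lemma pure_low n x : pure_elt w n x -> low_elt n x.
Proof. by case=> xd <-. Qed.

Lemma low_elt_le m n x : m <= n -> low_elt m x -> low_elt n x.
Proof. by move=> mn [xd h]; split=> //; exact: le_trans mn. Qed.

Lemma low_elt_neq0 n x : low_elt n x -> x != 0.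
Proof. by case=> xd _; apply: contraNneq (wdom_neq0 w) => <-. Qed.

Lemma low_eltM m n x y : low_elt m x -> low_elt n y -> low_elt (m + n) (x * y).
Proof.
by move=> [xd hx] [yd hy]; split; [exact: wdomM | rewrite wfunM // lerD].
Qed.

Lemma low_pure_disjoint n x : low_elt (n - 1) x -> pure_elt w n x -> False.
Proof. by move=> [_ h] [_ e]; move: h; rewrite e lerDl. Qed.

Lemma hgr_fin_dim (P : cplx k) i : fin_dim (P i) -> fin_dim (hgr P i : lmodType k).
Proof.
move=> fP; apply: (@fin_dim_quot _ (Defs.cycle P i : lmodType k) _ (@hclass k P i)).
- exact: hclass_linear.
- by elim/hclass_ind => z; exists z.
- by apply: (@fin_dim_sub _ _ _ val) fP => //; exact: val_inj.
Qed.

Definition pure_homology (P : cplx k) (f : cmap P P) : Prop :=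
  forall i (a : hgr P i), killed iota (pure_elt w i) (hmap f i) a.

Lemma pure_cmapP (P : cplx k) (f : cmap P P) : finite_type P ->
  pure_cmap iota w 0 f <-> pure_homology f.
Proof.
move=> fP; rewrite /pure_cmap; split=> h i.
  by move: (h i); rewrite add0r => /pure_endoP[].
by rewrite add0r; apply/pure_endoP; split=> //; exact: hgr_fin_dim.
Qed.

Lemma killed_id (V : lmodType k) (F : V -> V) x :
  F x = x -> killed iota (pure_elt w 0) F x.
Proof.
move=> Fx; exists ('X - 1%:P); last by rewrite polyactXsubC scale1r Fx subrr.
split=> [|z]; first by rewrite polyXsubC_eq0.
rewrite rmorphB /= map_polyX map_polyC /= rmorph1 root_XsubC => /eqP ->.
exact: pure_elt1.
Qed.

Lemma unit_finite_type : finite_type (@unit_cplx k).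
Proof. by move=> i; exists (nat_of_bool (i == 0)), id; split=> //; exists id. Qed.

Lemma Cw_unit : Cw_ob iota w unit_ob.
Proof.
split=> /=.
- by exists 0 => i i0 x; apply: unit_neq0; rewrite lt_eqF.
- exact: unit_finite_type.
apply/(pure_cmapP _ unit_finite_type) => i a.
have [i0|i0] := eqVneq i 0; last first.
  elim/hclass_ind: a => z; suff -> : hclass z = 0 by exact: killed0.
  by apply: hclass_val0; exact: unit_neq0.
rewrite [X in pure_elt w X]i0; apply: killed_id; elim/hclass_ind: a => z.
by rewrite hmapE; congr hclass; exact: val_inj.
Qed.

(** Lower bounds keep each degree of the tensor product finite dimensional. Purity is checked on
    products of classes, where weights i and j add up to n. *)
Lemma Cw_ten X Y : Cw_ob iota w X -> Cw_ob iota w Y -> Cw_ob iota w (ten X Y).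
Proof.
case: X Y => [P f] [Q g] [/= [lP bP] fP pf] [/= [lQ bQ] fQ pg].
have fPQ : finite_type (tcplx P Q) by move=> n; exact: gtens_fin_dim bP bQ fP fQ.
split=> //=.
- exists (lP + lQ) => n ln t; elim/gtens_ind: t => [//|t u -> ->|i j e x y].
    by rewrite addr0.
  have [iP|iP] := ltP i lP; first by rewrite (bP i iP x) pure0l.
  have [jQ|jQ] := ltP j lQ; first by rewrite (bQ j jQ y) pure0r.
  suff : lP + lQ <= n by rewrite leNgt ln.
  by rewrite -e lerD.
move/(pure_cmapP f fP) in pf; move/(pure_cmapP g fQ) in pg.
apply/(pure_cmapP _ fPQ) => n.
have [h hh] := splitting_exists fP; have [h' hh'] := splitting_exists fQ.
apply: (kunneth_ind hh hh') => [|a b|i j e a b].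
- exact: killed0.
- exact: killedD.
apply: (killed_bilinear (B := kunneth_fun e) (F1 := hmap f i) (F2 := hmap g j)
  _ _ _ _ _ (pf i a) (pg j b)).
- move=> c; exact: (bf_linearl (kunneth_bifam P Q n) e c).
- move=> c; exact: (bf_linearr (kunneth_bifam P Q n) e c).
- move=> c d; elim/hclass_ind: c => c; elim/hclass_ind: d => d.
  transitivity (kunneth_fun e (hclass (Defs.cycle_map f c)) (hclass (Defs.cycle_map g d))).
    rewrite !kunneth_class; apply: etrans (hmap_class _ _) _.
    by congr hclass; apply: val_inj; exact: tmap_pure.
  by congr kunneth_fun; exact/esym/hmap_class.
- exact: pure_elt_neq0.
- by rewrite -e; exact: pure_eltM.
Qed.

Lemma Cw_closed : monoidal_closed (Cw_ob iota w).
Proof. by split; [exact: Cw_unit | exact: Cw_ten]. Qed.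

Lemma Cw_stable X : Cw_ob iota w X -> Cw_ob iota w (endo_smfunctor (homology k) X).
Proof.
case: X => P f [/= [lP bP] fP pf].
have fH : finite_type (hcplx P) by move=> i; exact: hgr_fin_dim.
split=> //=.
- exists lP => i iP a; elim/hclass_ind: a => z.
  by apply: hclass_val0; exact: bP.
move/(pure_cmapP f fP) in pf; apply/(pure_cmapP _ fH) => i a.
elim/hclass_ind: a => z.
(* With zero differential every element is a cycle; purity is carried from H_i(P) to the homology of
   H(P) along x |-> [x]. *)
have hc (x : hcplx P i) : x \in is_cycle (hcplx P) i by apply/(is_cycleP (pred_deg i)).
have -> : hclass z = hclass (Cycle (hc (val z))) by congr hclass; exact: val_inj.
apply: (killed_nat (phi := fun x => hclass (Cycle (hc x))) (F := hmap f i)) (pf i _).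
- move=> a x y; rewrite -hclass_linear; congr hclass; exact: val_inj.
- by move=> x; rewrite hmapE; congr hclass; exact: val_inj.
Qed.

End Purity.

(** * Monoidal subfunctors and restriction to full subcategories *)

(* As [inc] is monic, the coherence of [kap] and [et] follows from that of [C]. *)
Section SubMonoidal.
Variables (C : smcat) (T : C -> C) (Tm : forall X Y : C, Defs.hom X Y -> Defs.hom (T X) (T Y)).
Variable inc : forall X : C, Defs.hom (T X) X.
Variable kap : forall X Y : C, Defs.hom (ten (T X) (T Y)) (T (ten X Y)).
Variable et : Defs.hom (@unit_ob C) (T unit_ob).
Hypothesis inc_mono : forall (X Y : C) (a b : Defs.hom X (T Y)),
  inc Y \oc a = inc Y \oc b -> a = b.
Hypothesis inc_nat : forall (X Y : C) (f : Defs.hom X Y), inc Y \oc Tm f = f \oc inc X.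
Hypothesis inc_kap : forall X Y : C, inc (ten X Y) \oc kap X Y = tenm (inc X) (inc Y).
Hypothesis inc_et : inc unit_ob \oc et = idm unit_ob.

Definition sub_functor : functor C C.
Proof.
refine (@Functor C C T Tm _ _).
- by move=> X; apply: inc_mono; rewrite inc_nat comp1m compm1.
- by move=> X Y Z g f; apply: inc_mono; rewrite inc_nat Defs.compA inc_nat -!Defs.compA inc_nat.
Defined.

Definition sub_smfunctor : smfunctor C C.
Proof.
refine (@SMFunctor C C sub_functor kap et _ _ _ _ _) => /=.
- move=> X X' Y Y' f g; apply: inc_mono.
  by rewrite !Defs.compA inc_kap inc_nat -Defs.compA inc_kap -!tenm_comp !inc_nat.
- move=> X Y Z; apply: inc_mono.
  rewrite !Defs.compA inc_nat inc_kap -(Defs.compA (assoc _ _ _)) inc_kap -Defs.compA -!tenm_comp.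
  by rewrite inc_kap !compm1 assoc_nat inc_kap.
- move=> X; apply: inc_mono.
  rewrite !Defs.compA inc_nat -(Defs.compA (lunit _)) inc_kap -Defs.compA -tenm_comp inc_et compm1.
  exact: lunit_nat.
- move=> X; apply: inc_mono.
  rewrite !Defs.compA inc_nat -(Defs.compA (runit _)) inc_kap -Defs.compA -tenm_comp inc_et compm1.
  exact: runit_nat.
- move=> X Y; apply: inc_mono.
  rewrite !Defs.compA inc_nat inc_kap -Defs.compA inc_kap; exact: braid_nat.
Defined.

Definition sub_smtrans : smtrans sub_smfunctor (id_smfunctor C).
Proof.
refine (@SMTrans C C sub_smfunctor (id_smfunctor C) inc _ _ _) => /=.
- exact: inc_nat.
- by move=> X Y; rewrite comp1m.
- exact: inc_et.
Defined.
End SubMonoidal.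

Section FullTransformations.
Variables (C : smcat) (S : C -> Prop) (cl : monoidal_closed S).
Variables (F : smfunctor C C) (FS : forall X, S X -> S (F X)).

Definition full_smtrans_id (t : smtrans F (id_smfunctor C)) :
  smtrans (full_smfunctor cl FS) (id_smfunctor (full_smcat cl)).
Proof.
refine (@SMTrans (full_smcat cl) (full_smcat cl) (full_smfunctor cl FS)
  (id_smfunctor (full_smcat cl)) (fun X => t (sval X)) _ _ _) => /=.
- move=> X Y f; exact: (smt_nat t).
- move=> X Y; exact: (smt_kappa t).
- exact: (smt_eta t).
Defined.

Variables (G : smfunctor C C) (GS : forall X, S X -> S (G X)).
Variable t : forall X, S X -> Defs.hom (F X) (G X).
Hypothesis t_nat : forall X Y (sX : S X) (sY : S Y) (f : Defs.hom X Y),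
  t sY \oc fmap F f = fmap G f \oc t sX.
Hypothesis t_kappa : forall X Y (sX : S X) (sY : S Y) (sXY : S (ten X Y)),
  t sXY \oc kappa F X Y = kappa G X Y \oc tenm (t sX) (t sY).
Hypothesis t_eta : forall s1 : S unit_ob, t s1 \oc Defs.eta F = Defs.eta G.

(** The components take the proof of [S X] as an argument because the projection onto homology is
    defined from the purity of the object. *)
Definition full_smtrans : smtrans (full_smfunctor cl FS) (full_smfunctor cl GS).
Proof.
refine (@SMTrans (full_smcat cl) (full_smcat cl) (full_smfunctor cl FS)
  (full_smfunctor cl GS) (fun X => t (svalP X)) _ _ _) => /=.
- move=> X Y f; exact: t_nat.
- move=> X Y; exact: t_kappa.
- exact: t_eta.
Defined.
End FullTransformations.

(** * Composition and tensor products in the category of complexes with an endomorphism *)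

Section EndoComplex.
Variable k : fieldType.
Notation EC := (endo_smcat (cplx_smcat k)).

(* Unification diverges when it unfolds [endo_smcat (cplx_smcat k)] in one step,
   hence these equations, one for each layer. *)
Lemma ehom_comp (C : smcat) (X Y Z : endo_smcat C) (g : Defs.hom Y Z)
    (f : Defs.hom X Y) : ehom (Defs.comp g f) = Defs.comp (ehom g) (ehom f).
Proof. by []. Qed.

Lemma ehom_tenm (C : smcat) (X X' Y Y' : endo_smcat C) (f : Defs.hom X X')
    (g : Defs.hom Y Y') : ehom (tenm f g) = tenm (ehom f) (ehom g).
Proof. by []. Qed.

Lemma comp_cplx (P Q R : cplx_smcat k) (g : Defs.hom Q R) (f : Defs.hom P Q) :
  Defs.comp g f = ccomp g f.
Proof. by []. Qed.

Lemma tenm_cplx (P P' Q Q' : cplx_smcat k) (f : Defs.hom P P') (g : Defs.hom Q Q') :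
  tenm f g = tmap f g.
Proof. by []. Qed.

Lemma ehom_ccomp (X Y Z : EC) (g : Defs.hom Y Z) (f : Defs.hom X Y) :
  ehom (Defs.comp g f) = ccomp (ehom g) (ehom f).
Proof. by rewrite ehom_comp comp_cplx. Qed.

Lemma ehom_tmap (X X' Y Y' : EC) (f : Defs.hom X X') (g : Defs.hom Y Y') :
  ehom (tenm f g) = tmap (ehom f) (ehom g).
Proof. by rewrite ehom_tenm tenm_cplx. Qed.

Lemma endo_homE (X Y : EC) (f : Defs.hom X Y) i x :
  cm (ehom f) i (cm (emap X) i x) = cm (emap Y) i (cm (ehom f) i x).
Proof. exact: (congr1 (fun h : cmap (eob X) (eob Y) => cm h i x) (ehomE f)). Qed.

End EndoComplex.

(** * The truncation functor *)

Section Truncation.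
Variables (k : fieldType) (K : closedFieldType) (iota : {rmorphism k -> K}).
Variable w : weight K.

Section TruncComplex.
Variables (P : cplx k) (f : cmap P P).

Definition is_trunc i : {pred P i} := fun x =>
  `[< exists (a : Defs.cycle P i) (y : P i),
      [/\ x = val a + y, killed iota (low_elt w i) (f i) (val a)
        & killed iota (low_elt w (i - 1)) (f i) y] >].
Arguments is_trunc : clear implicits.

Lemma is_truncP i (x : P i) :
  reflect (exists (a : Defs.cycle P i) (y : P i),
      [/\ x = val a + y, killed iota (low_elt w i) (f i) (val a)
        & killed iota (low_elt w (i - 1)) (f i) y]) (x \in is_trunc i).
Proof. exact: asboolP. Qed.

Lemma trunc_cycle i (a : Defs.cycle P i) :
  killed iota (low_elt w i) (f i) (val a) -> val a \in is_trunc i.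
Proof.
by move=> ha; apply/is_truncP; exists a, 0; split; rewrite ?addr0 //; exact: killed0.
Qed.

Lemma trunc_low i (y : P i) :
  killed iota (low_elt w (i - 1)) (f i) y -> y \in is_trunc i.
Proof.
by move=> hy; apply/is_truncP; exists 0, y; split; rewrite ?add0r //; exact: killed0.
Qed.

Lemma is_trunc_linear i a x y :
  x \in is_trunc i -> y \in is_trunc i -> a *: x + y \in is_trunc i.
Proof.
move=> /is_truncP[c [u [-> hc hu]]] /is_truncP[d [v [-> hd hv]]].
apply/is_truncP; exists (a *: c + d), (a *: u + v); split.
- by rewrite scalerDr addrACA.
- exact: killedP.
- exact: killedP.
Qed.

Lemma is_trunc0 i : 0 \in is_trunc i.
Proof. by apply: trunc_low; exact: killed0. Qed.

Lemma is_trunc_closed i : subsemimod_closed (is_trunc i).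
Proof.
split; [split|].
- exact: is_trunc0.
- by move=> x y hx hy; rewrite -[x]scale1r; exact: is_trunc_linear.
- move=> a x hx; rewrite -[_ *: _]addr0; apply: is_trunc_linear => //.
  exact: is_trunc0.
Qed.
HB.instance Definition _ i :=
  GRing.isSubmodClosed.Build k (P i) (is_trunc i) (is_trunc_closed i).

Record trunc i := Trunc { trval : P i; trvalP : trval \in is_trunc i }.
HB.instance Definition _ i := [isSub for @trval i].
HB.instance Definition _ i := [Choice of trunc i by <:].
HB.instance Definition _ i := [SubChoice_isSubLmodule of trunc i by <:].

Lemma trunc_diff_subproof i j (e : i = j + 1) (x : trunc i) :
  diff e (trval x) \in is_trunc j.
Proof.
have /is_truncP[a [y [-> _ hy]]] := trvalP x.
rewrite diffD (is_cycleP e _ (cvalP a)) add0r.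
have hd : diff e y \in is_cycle P j by apply/(is_cycleP (pred_deg j)); rewrite diff_diff.
rewrite -[diff e y]/(val (Cycle hd)); apply: trunc_cycle.
have ej : i - 1 = j by rewrite e addrK.
rewrite ej in hy; apply: killed_nat hy; first exact: diff_linear.
by move=> z; rewrite cm_diff.
Qed.

Definition trunc_cplx : cplx k.
Proof.
refine (@Cplx k (fun i => trunc i : lmodType k)
  (fun i j e x => Trunc (trunc_diff_subproof e x)) _ _).
- by move=> i j e a x y; apply: val_inj; rewrite /= diffD diffZ.
- by move=> i j l e e' x; apply: val_inj; rewrite /= diff_diff.
Defined.

Definition trunc_incl : cmap trunc_cplx P.
Proof. by refine (@CMap k trunc_cplx P trval _ _). Defined.

End TruncComplex.
Arguments is_trunc {P} f i.

Section TruncMap.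
Variables (P Q : cplx k) (f : cmap P P) (g : cmap Q Q) (phi : cmap P Q).
Hypothesis phiE : ccomp phi f = ccomp g phi.

Lemma trunc_map_subproof i (x : P i) :
  x \in is_trunc f i -> phi i x \in is_trunc g i.
Proof.
have nat y : phi i (f i y) = g i (phi i y).
  by rewrite -ccompE phiE.
move=> /is_truncP[a [y [-> ha hy]]]; apply/is_truncP.
exists (Defs.cycle_map phi a), (phi i y); split; first exact: linearD.
- by apply: killed_nat ha => //; exact: cm_linear.
- by apply: killed_nat hy => //; exact: cm_linear.
Qed.

Definition trunc_map : cmap (trunc_cplx f) (trunc_cplx g).
Proof.
refine (@CMap k (trunc_cplx f) (trunc_cplx g)
  (fun i x => Trunc (trunc_map_subproof (trvalP x))) _ _).
- by move=> i a x y; apply: val_inj; rewrite /= linearP.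
- by move=> i j e x; apply: val_inj; exact: cm_diff.
Defined.
End TruncMap.

Section TruncTensor.
Variables (P Q : cplx k) (f : cmap P P) (g : cmap Q Q).

Lemma killed_tens m m' l n i j (e : i + j = n) (x : P i) (y : Q j) : m + m' <= l ->
  killed iota (low_elt w m) (f i) x -> killed iota (low_elt w m') (g j) y ->
  killed iota (low_elt w l) (tmap f g n) (pure_tens e x y).
Proof.
move=> le; apply: killed_bilinear.
- by move=> z; exact: pure_linearl.
- by move=> z; exact: pure_linearr.
- by move=> u v; exact: tmap_pure.
- exact: low_elt_neq0.
- by move=> z t hz ht; apply: low_elt_le le _; exact: low_eltM.
Qed.

(** The remainder a (x) v + u (x) (b + v) has weights at most i + (j - 1) or (i - 1) + j, both n -
    1. This gives both the closure of T under tensor products and the compatibility of the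
    projection with the Kuenneth morphism. *)
Lemma tens_low_remainder n i j (e : i + j = n) (a u : P i) (b v : Q j) :
  killed iota (low_elt w i) (f i) a -> killed iota (low_elt w (i - 1)) (f i) u ->
  killed iota (low_elt w j) (g j) b -> killed iota (low_elt w (j - 1)) (g j) v ->
  exists2 r, pure_tens e (a + u) (b + v) = pure_tens e a b + r
    & killed iota (low_elt w (n - 1)) (tmap f g n) r.
Proof.
move=> ha hu hb hv; exists (pure_tens e a v + pure_tens e u (b + v)).
  by rewrite pureDl !pureDr !addrA.
have hbv : killed iota (low_elt w j) (g j) (b + v).
  apply: killedD => //; apply: killed_sub hv => z; apply: low_elt_le.
  by rewrite gerDl.
apply: killedD.
- by apply: killed_tens ha hv; rewrite addrA e.
- by apply: killed_tens hu hbv; rewrite addrAC e.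
Qed.

Lemma trunc_tens n i j (e : i + j = n) (x : P i) (y : Q j) :
  x \in is_trunc f i -> y \in is_trunc g j ->
  (pure_tens e x y : tcplx P Q n) \in is_trunc (tmap f g) n.
Proof.
move=> /is_truncP[a [u [-> ha hu]]] /is_truncP[b [v [-> hb hv]]].
have [r er hr] := tens_low_remainder e ha hu hb hv.
apply/is_truncP; exists (cycle_tens e a b), r; split=> //.
by apply: killed_tens ha hb; rewrite e.
Qed.

Definition trunc_tens_bifam n :
  bifam (trunc_cplx f) (trunc_cplx g) n (trunc_cplx (tmap f g) n).
Proof.
refine (@Bifam k (trunc_cplx f) (trunc_cplx g) n (trunc_cplx (tmap f g) n)
  (fun i j e x y => Trunc (trunc_tens e (trvalP x) (trvalP y))) _ _).
- by move=> i j e y a x x'; apply: val_inj; rewrite /= pureDl pureZl.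
- by move=> i j e x a y y'; apply: val_inj; rewrite /= pureDr pureZr.
Defined.

Definition trunc_kappa :
  cmap (tcplx (trunc_cplx f) (trunc_cplx g)) (trunc_cplx (tmap f g)).
Proof.
refine (@CMap k (tcplx (trunc_cplx f) (trunc_cplx g)) (trunc_cplx (tmap f g))
  (fun n => tlift (trunc_tens_bifam n)) _ _).
- by move=> n; exact: tlift_linear.
- move=> n m e t; elim/gtens_ind: t => [|t u ht hu|i j eij x y].
  + by rewrite !linear0.
  + by rewrite !linearD /= ht hu.
  rewrite tdiff_pure linearD linearZ /= !tlift_pure; apply: val_inj => /=.
  by rewrite [RHS]tdiff_pure.
Defined.

Lemma trunc_kappa_pure n i j (e : i + j = n) x y :
  trunc_kappa n (pure_tens (P := trunc_cplx f) (Q := trunc_cplx g) e x y)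
  = Trunc (trunc_tens e (trvalP x) (trvalP y)).
Proof. exact: tlift_pure. Qed.
End TruncTensor.

Lemma trunc_unit_subproof i (a : @unit_cplx k i) :
  a \in is_trunc (Defs.cid unit_cplx) i.
Proof.
have [i0|i0] := eqVneq i 0; last by rewrite (unit_neq0 a i0) is_trunc0.
rewrite -[a]/(val (unit_cycle a)); apply: trunc_cycle.
by rewrite [X in low_elt w X]i0; apply: (killed_sub (@pure_low _ w 0)); exact: killed_id.
Qed.

Definition trunc_unit : cmap (@unit_cplx k) (trunc_cplx (Defs.cid unit_cplx)).
Proof.
refine (@CMap k unit_cplx (trunc_cplx (Defs.cid unit_cplx))
  (fun i a => Trunc (trunc_unit_subproof a)) _ _).
- by move=> i a x y; apply: val_inj.
- by move=> i j e x; apply: val_inj.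
Defined.

Section TruncFunctor.

(** An endomorphism commutes with itself, so [trunc_map] at [erefl] is its restriction to T. *)
Definition trunc_endo (X : endo_smcat (cplx_smcat k)) : endo_smcat (cplx_smcat k) :=
  @EndoOb (cplx_smcat k) (trunc_cplx (emap X))
    (trunc_map (erefl : ccomp (emap X) (emap X) = ccomp (emap X) (emap X))).

Definition trunc_hom X Y (f : Defs.hom X Y) : Defs.hom (trunc_endo X) (trunc_endo Y).
Proof.
refine (@EndoHom (cplx_smcat k) (trunc_endo X) (trunc_endo Y) (trunc_map (ehomE f)) _).
by apply: cmap_eq => i x; apply: val_inj; exact: endo_homE.
Defined.

Definition trunc_inc (X : endo_smcat (cplx_smcat k)) : Defs.hom (trunc_endo X) X.
Proof.
refine (@EndoHom (cplx_smcat k) (trunc_endo X) X (trunc_incl (emap X)) _).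
by apply: cmap_eq.
Defined.

Lemma trunc_kappa_endo (P Q : cplx k) (f : cmap P P) (g : cmap Q Q) :
  ccomp (trunc_kappa f g)
    (tmap (trunc_map (erefl : ccomp f f = ccomp f f))
          (trunc_map (erefl : ccomp g g = ccomp g g)))
  = ccomp (trunc_map (erefl : ccomp (tmap f g) (tmap f g) = ccomp (tmap f g) (tmap f g)))
      (trunc_kappa f g).
Proof.
apply: cmap_ext2 => i j x y; rewrite !ccompE tmap_pure !trunc_kappa_pure.
by apply: val_inj; symmetry; exact: tmap_pure.
Qed.

Definition trunc_endo_kappa X Y :
  Defs.hom (ten (trunc_endo X) (trunc_endo Y)) (trunc_endo (ten X Y)) :=
  @EndoHom (cplx_smcat k) (endo_ten (trunc_endo X) (trunc_endo Y))
    (trunc_endo (endo_ten X Y)) (trunc_kappa (emap X) (emap Y))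
    (trunc_kappa_endo (emap X) (emap Y)).

Definition trunc_endo_eta : Defs.hom unit_ob (trunc_endo unit_ob).
Proof.
refine (@EndoHom (cplx_smcat k) (@unit_ob (endo_smcat (cplx_smcat k)))
  (trunc_endo unit_ob) trunc_unit _).
by apply: cmap_eq => i x; apply: val_inj.
Defined.

Lemma trunc_inc_mono X Y (a b : Defs.hom X (trunc_endo Y)) :
  trunc_inc Y \oc a = trunc_inc Y \oc b -> a = b.
Proof.
move=> e; apply: endo_hom_eq; apply: cmap_eq => i x; apply: val_inj.
by have /(congr1 (fun h : Defs.hom X Y => cm (ehom h) i x)) := e.
Qed.

Lemma trunc_inc_nat X Y (f : Defs.hom X Y) :
  trunc_inc Y \oc trunc_hom f = f \oc trunc_inc X.
Proof. by apply: endo_hom_eq; apply: cmap_eq. Qed.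

Lemma trunc_incl_kappa (P Q : cplx k) (f : cmap P P) (g : cmap Q Q) :
  ccomp (trunc_incl (tmap f g)) (trunc_kappa f g) = tmap (trunc_incl f) (trunc_incl g).
Proof.
by apply: cmap_ext2 => i j x y; rewrite ccompE trunc_kappa_pure tmap_pure.
Qed.

Lemma trunc_inc_kappa X Y :
  trunc_inc (ten X Y) \oc trunc_endo_kappa X Y = tenm (trunc_inc X) (trunc_inc Y).
Proof.
apply: endo_hom_eq; rewrite [LHS]ehom_ccomp [RHS]ehom_tmap.
exact (trunc_incl_kappa (emap X) (emap Y)).
Qed.

Lemma trunc_inc_eta : trunc_inc unit_ob \oc trunc_endo_eta = idm unit_ob.
Proof. by apply: endo_hom_eq; apply: cmap_eq. Qed.

Definition trunc_smfunctor :
    smfunctor (endo_smcat (cplx_smcat k)) (endo_smcat (cplx_smcat k)) :=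
  sub_smfunctor trunc_inc_mono trunc_inc_nat trunc_inc_kappa trunc_inc_eta.

Definition trunc_inc_smtrans :
    smtrans trunc_smfunctor (id_smfunctor (endo_smcat (cplx_smcat k))) :=
  sub_smtrans trunc_inc_mono trunc_inc_nat trunc_inc_kappa trunc_inc_eta.

End TruncFunctor.
End Truncation.

(** * The projection onto homology *)

Lemma bijective_surj T U (f : T -> U) :
  injective f -> (forall y, exists x, f x = y) -> bijective f.
Proof.
by move=> fi /choice[g gK]; exists g => // x; apply: fi; rewrite gK.
Qed.

Section TruncationHomology.
Variables (k : fieldType) (K : closedFieldType) (iota : {rmorphism k -> K}).
Variable w : weight K.

Section Projection.
Variables (P : cplx k) (f : cmap P P).
Hypothesis pf : pure_homology iota w f.
Notation TP := (trunc_cplx iota w f).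
Notation low n i := (killed iota (low_elt w n) (cm f i)).

Lemma trval_inj i : injective (@trval k K iota w P f i).
Proof. exact: val_inj. Qed.

Lemma cycle_map_linear i : linear (@Defs.cycle_map k P P f i).
Proof. by move=> a x y; apply: val_inj; rewrite /= linearP. Qed.

HB.instance Definition _ i := GRing.isLinear.Build k (Defs.cycle P i) (Defs.cycle P i) _
  (@Defs.cycle_map k P P f i) (@cycle_map_linear i).

Lemma polyact_hclass p i (a : Defs.cycle P i) :
  polyact p (hmap f i) (hclass a) = hclass (polyact p (@Defs.cycle_map k P P f i) a).
Proof.
rewrite -(polyact_nat (F := @Defs.cycle_map k P P f i)) //; first exact: hclass_linear.
by move=> y; rewrite hmapE.
Qed.

Lemma polyact_val p i (a : Defs.cycle P i) :
  val (polyact p (@Defs.cycle_map k P P f i) a) = polyact p (f i) (val a).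
Proof. by rewrite -(polyact_nat (F := @Defs.cycle_map k P P f i)). Qed.

Lemma polyact_diff p i j (e : i = j + 1) (x : P i) :
  diff e (polyact p (f i) x) = polyact p (f j) (diff e x).
Proof. by apply: polyact_nat; [exact: diff_linear | move=> y; rewrite cm_diff]. Qed.

Lemma low_cycle_class0 i (a : Defs.cycle P i) : low (i - 1) i (val a) -> hclass a = 0.
Proof.
move=> [p hp pa]; apply: (killed_disjoint (@low_pure_disjoint _ w i) _ (@pf i (hclass a))).
exists p => //; apply: etrans (polyact_hclass p a) _; apply: hclass_val0.
by rewrite polyact_val.
Qed.

Definition trunc_proj_fun i (x : TP i) : hgr P i :=
  hclass (projT1 (cid (elimT (is_truncP _ _ _ _) (trvalP x)))).

(** Two decompositions a + y = b + z give b - a = y - z, which is both a cycle and in low_(i-1),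
    hence a boundary: the choice made by [cid] does not matter. *)
Lemma trunc_proj_uniq i (x : TP i) (a : Defs.cycle P i) y :
  trval x = val a + y -> low (i - 1) i y -> trunc_proj_fun x = hclass a.
Proof.
move=> e hy; rewrite /trunc_proj_fun; case: cid => b [z [e' _ hz]] /=.
have hba : hclass (-1 *: a + b) = 0.
  apply: low_cycle_class0.
  have -> : val (-1 *: a + b) = -1 *: z + y.
    have vb : val b = val a + y - z by rewrite -e e' addrK.
    transitivity (-1 *: val a + val b); first by [].
    by rewrite vb !scaleN1r -addrA addKr addrC.
  exact: killedP.
by apply/eqP; rewrite -subr_eq0 addrC -scaleN1r -hclass_linear hba.
Qed.

Lemma trunc_proj_ex i (x : TP i) : exists (a : Defs.cycle P i) y,
  [/\ trval x = val a + y, low i i (val a), low (i - 1) i y & trunc_proj_fun x = hclass a].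
Proof.
have /is_truncP[a [y [e ha hy]]] := trvalP x; exists a, y; split=> //.
exact: trunc_proj_uniq e hy.
Qed.

Lemma trunc_proj_linear i : linear (@trunc_proj_fun i).
Proof.
move=> c x x'; have [a [y [e _ hy ->]]] := trunc_proj_ex x.
have [a' [y' [e' _ hy' ->]]] := trunc_proj_ex x'.
rewrite -hclass_linear; apply: (trunc_proj_uniq (y := c *: y + y')).
  transitivity (c *: trval x + trval x'); first by [].
  by rewrite e e' scalerDr addrACA.
exact: killedP.
Qed.

Definition trunc_proj : cmap TP (hcplx P).
Proof.
refine (@CMap k TP (hcplx P) trunc_proj_fun trunc_proj_linear _).
move=> i j e x; rewrite [RHS]/(0); have [a [y [ex _ hy _]]] := trunc_proj_ex x.
have hd : diff e y \in is_cycle P j by apply/(is_cycleP (pred_deg j)); rewrite diff_diff.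
(* Here d x = d y is its own cycle part, with remainder 0, and its class vanishes because y bounds
   it in P. *)
rewrite (trunc_proj_uniq (a := Cycle hd) (y := 0)).
- rewrite -[RHS]/(hclass (0 : Defs.cycle P j)); apply/hclass_eqP; subst i; exists y.
  by rewrite subr0.
- rewrite addr0; transitivity (diff e (trval x)); first by [].
  by rewrite ex diffD (is_cycleP e _ (cvalP a)) add0r.
- exact: killed0.
Defined.

Hypothesis fP : finite_type P.

Lemma boundary_low i (z : P (i + 1)) : low i i (diff erefl z) ->
  exists2 u : P (i + 1), low i (i + 1) u & diff erefl u = diff erefl z.
Proof.
have [m m0 hm] := fin_dim_killed (cm f (i + 1)) (fP (i + 1)).
move=> [p hp pz]; have [m1 [m2 [n [dm cop m1p]]]] := coprime_split m0 hp.1.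
have /Bezout_eq1_coprimepP[[s r] /= e] := cop.
(* As s m2 + r p = 1, s m2 fixes what p kills, in particular d z. As m1 m2 kills z and m1 divides
   p^n, the new element is killed by p^n. *)
exists (polyact (s * m2) (f (i + 1)) z).
  exists (p ^+ n); first exact: roots_in_exp.
  rewrite -polyactM; apply: polyact_dvd (hm z).
  by rewrite dm mulrA dvdp_mul // dvdp_mulr.
by rewrite polyact_diff -[RHS](polyact1 (f i)) -e polyactD (polyactM _ r) pz polyactr0 addr0.
Qed.

Lemma low_representative i (a : Defs.cycle P i) :
  exists2 b : Defs.cycle P i, hclass b = hclass a & low i i (val b).
Proof.
have [p hp pa] := @pf i (hclass a).
have [z hz] : exists z : P (i + 1), polyact p (f i) (val a) = diff erefl z.
  move: pa => /(etrans (esym (polyact_hclass p a))).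
  rewrite -[RHS]/(hclass (0 : Defs.cycle P i)) => /hclass_eqP[z].
  by rewrite polyact_val subr0; exists z.
(* The annihilator is taken in degree i + 1, where z lives. Applying s m2 = 1 - r p changes a by the
   boundary of r z, and p^n p kills the result, since p a = d z and p^n s m2 kills z. *)
have [m m0 hm] := fin_dim_killed (cm f (i + 1)) (fP (i + 1)).
have [m1 [m2 [n [dm cop m1p]]]] := coprime_split m0 hp.1.
have /Bezout_eq1_coprimepP[[s r] /= e] := cop.
exists (polyact (s * m2) (@Defs.cycle_map k P P f i) a).
  apply/hclass_eqP; exists (polyact (- r) (f (i + 1)) z).
  rewrite polyact_diff -hz polyact_val -polyactM.
  rewrite -[X in _ - X](polyact1 (f i)) -e polyactD opprD addrA subrr add0r.
  by rewrite mulNr polyactN.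
apply: (killed_sub (@pure_low _ w i)).
exists (p ^+ n * p); first by apply: roots_inM => //; exact: roots_in_exp.
rewrite polyact_val -polyactM mulrAC polyactM hz -polyact_diff.
by rewrite (polyact_dvd _ (hm z)) ?linear0 // dm mulrA dvdp_mul // dvdp_mulr.
Qed.

Lemma trunc_val_low i (x : TP i) : low i i (trval x).
Proof.
have [a [y [-> ha hy _]]] := trunc_proj_ex x; apply: killedD => //.
by apply: killed_sub hy => z; apply: low_elt_le; rewrite gerDl.
Qed.

Notation inc := (trunc_incl iota w f).

Lemma trunc_incl_quasi_iso : quasi_iso inc.
Proof.
move=> i; apply: bijective_surj => [x y|].
  elim/hclass_ind: x => x; elim/hclass_ind: y => y; rewrite !hmapE => /hclass_eqP[z hz].
  have [] := @boundary_low i z.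
    have <- : -1 *: trval (val y) + trval (val x) = diff erefl z.
      by rewrite scaleN1r addrC; exact: hz.
    by apply: killedP; exact: trunc_val_low.
  move=> u hu du.
  (* In degree i + 1 the second summand of T allows weights up to (i + 1) - 1 = i, exactly the bound
     on u. *)
  have tu : u \in @is_trunc k K iota w P f (i + 1) by apply: trunc_low; rewrite addrK.
  apply/hclass_eqP; exists (Trunc tu); apply: val_inj.
  exact: etrans hz (esym du).
elim/hclass_ind => a; have [b <- hb] := low_representative a.
have cb : Trunc (trunc_cycle hb) \in is_cycle TP i.
  apply/(@is_cycleP k TP i _ (pred_deg i)); apply: trval_inj.
  exact: (is_cycleP (pred_deg i) _ (cvalP b)).
by exists (hclass (Cycle cb)); rewrite hmapE; congr hclass; exact: val_inj.
Qed.

Lemma trunc_proj_quasi_iso : quasi_iso trunc_proj.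
Proof.
move=> i.
have hc (x : hcplx P i) : x \in is_cycle (hcplx P) i by apply/(is_cycleP (pred_deg i)).
(* The identification of H(P) with its own homology; composed with the map induced by the inclusion,
   it is the map induced by the projection. *)
have bc : bijective (fun x : hgr P i => hclass (Cycle (hc x)) : hgr (hcplx P) i).
  apply: bijective_surj => [x y /hclass_eqP[z hz]|].
    by apply/eqP; rewrite -subr_eq0; apply/eqP.
  by elim/hclass_ind => c; exists (val c); congr hclass; exact: val_inj.
apply: (eq_bij (bij_comp bc (trunc_incl_quasi_iso i))).
elim/hclass_ind => c; apply: etrans _ (esym (hmapE trunc_proj c)).
congr hclass; apply: val_inj; apply: etrans (hmapE inc c) _.
have [a [y [e _ hy ea]]] := trunc_proj_ex (val c); apply: etrans _ (esym ea).
(* For a cycle c = a + y of T, the difference y = c - a is a cycle in low_(i-1), so a and c have the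
   same class. *)
have h0 : hclass (-1 *: a + Defs.cycle_map inc c) = 0.
  apply: low_cycle_class0; suff -> : val (-1 *: a + Defs.cycle_map inc c) = y by [].
  transitivity (-1 *: val a + trval (val c)); first by [].
  by rewrite e scaleN1r addKr.
by apply/eqP; rewrite -subr_eq0 addrC -scaleN1r -hclass_linear h0.
Qed.

(** H(T) embeds into H(P) compatibly with the endomorphisms, so annihilating polynomials pull back;
    this keeps T inside the category. *)
Lemma trunc_pure :
  pure_homology iota w (trunc_map iota w (erefl : ccomp f f = ccomp f f)).
Proof.
move=> i a.
apply: (killed_inj (phi := hmap inc i) (G := hmap f i)).
- exact: linearP.
- exact: bij_inj (trunc_incl_quasi_iso i).
- elim/hclass_ind => c; rewrite !hmapE; congr hclass; exact: val_inj.
exact: pf.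
Qed.

End Projection.
End TruncationHomology.

(** * Naturality and monoidality of the projection onto homology *)

Section ProjectionMonoidal.
Variables (k : fieldType) (K : closedFieldType) (iota : {rmorphism k -> K}).
Variable w : weight K.

Lemma trunc_proj_nat (P Q : cplx k) (f : cmap P P) (g : cmap Q Q)
    (pf : pure_homology iota w f) (pg : pure_homology iota w g) (phi : cmap P Q)
    (h : ccomp phi f = ccomp g phi) :
  ccomp (trunc_proj pg) (trunc_map iota w h) = ccomp (hmap phi) (trunc_proj pf).
Proof.
apply: cmap_eq => i x; rewrite !ccompE.
have [a [y [e _ hy ea]]] := trunc_proj_ex pf x.
have nat z : phi i (f i z) = g i (phi i z) by rewrite -ccompE h.
apply: etrans (trunc_proj_uniq pg (a := Defs.cycle_map phi a) (y := phi i y) _ _) _.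
- by transitivity (phi i (trval x)) => //; rewrite e linearD.
- by apply: killed_nat hy => //; exact: cm_linear.
- by rewrite -hmapE; congr (hmap phi i _); exact: esym ea.
Qed.

Lemma trunc_proj_kappa (P Q : cplx k) (f : cmap P P) (g : cmap Q Q)
    (pf : pure_homology iota w f) (pg : pure_homology iota w g) (pfg : pure_homology iota w (tmap f g)) :
  ccomp (trunc_proj pfg) (trunc_kappa iota w f g)
  = ccomp (kunneth P Q) (tmap (trunc_proj pf) (trunc_proj pg)).
Proof.
apply: cmap_ext2 => i j x y; rewrite !ccompE trunc_kappa_pure tmap_pure.
have [a [u [ex ha hu ea]]] := trunc_proj_ex pf x.
have [b [v [ey hb hv eb]]] := trunc_proj_ex pg y.
rewrite -[trunc_proj pf i x]/(trunc_proj_fun x) -[trunc_proj pg j y]/(trunc_proj_fun y).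
rewrite ea eb kunneth_pure.
have [r er hr] := tens_low_remainder erefl ha hu hb hv.
apply: (trunc_proj_uniq pfg (a := cycle_tens erefl a b) (y := r)) => //.
by rewrite /= -er -ex -ey.
Qed.

Lemma trunc_proj_eta (p1 : pure_homology iota w (Defs.cid unit_cplx)) :
  ccomp (trunc_proj p1) (trunc_unit iota w) = hunit k.
Proof.
apply: cmap_eq => i a; rewrite ccompE hunitE.
apply: (trunc_proj_uniq p1 (a := unit_cycle a) (y := 0)); first by rewrite addr0.
exact: killed0.
Qed.

Lemma Cw_pure_homology X : Cw_ob iota w X -> pure_homology iota w (emap X).
Proof. by case=> _ fX pX; apply/(pure_cmapP iota w _ fX). Qed.

Lemma Cw_trunc X : Cw_ob iota w X -> Cw_ob iota w (trunc_smfunctor iota w X).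
Proof.
move=> hX; have [[l bX] fX _] := hX.
have fT : finite_type (trunc_cplx iota w (emap X)).
  move=> i; apply: fin_dim_sub (@cm_linear _ _ _ (trunc_incl iota w (emap X)) i) _ (fX i).
  exact: trval_inj.
split=> //.
- by exists l => i il x; apply: trval_inj; exact: bX.
- apply/(pure_cmapP iota w _ fT); exact: trunc_pure (Cw_pure_homology hX) fX.
Qed.

Definition trunc_proj_endo X (hX : Cw_ob iota w X) :
  Defs.hom (trunc_smfunctor iota w X) (endo_smfunctor (homology k) X) :=
  @EndoHom (cplx_smcat k) (trunc_endo iota w X) (endo_functor (homology k) X)
    (trunc_proj (Cw_pure_homology hX))
    (trunc_proj_nat (Cw_pure_homology hX) (Cw_pure_homology hX)
       (erefl : ccomp (emap X) (emap X) = ccomp (emap X) (emap X))).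

Lemma trunc_proj_endo_nat X Y (hX : Cw_ob iota w X) (hY : Cw_ob iota w Y)
    (f : Defs.hom X Y) :
  trunc_proj_endo hY \oc fmap (trunc_smfunctor iota w) f
  = fmap (endo_smfunctor (homology k)) f \oc trunc_proj_endo hX.
Proof.
apply: endo_hom_eq; rewrite [LHS]ehom_ccomp [RHS]ehom_ccomp.
exact (trunc_proj_nat (Cw_pure_homology hX) (Cw_pure_homology hY) (ehomE f)).
Qed.

(* Keeps unification from unfolding [tmap] before [emap (ten X Y)]. *)
Opaque tmap tcplx.

Lemma trunc_proj_endo_kappa X Y (hX : Cw_ob iota w X) (hY : Cw_ob iota w Y)
    (hXY : Cw_ob iota w (ten X Y)) :
  trunc_proj_endo hXY \oc kappa (trunc_smfunctor iota w) X Y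
  = kappa (endo_smfunctor (homology k)) X Y
    \oc tenm (trunc_proj_endo hX) (trunc_proj_endo hY).
Proof.
apply: endo_hom_eq; rewrite [LHS]ehom_ccomp [RHS]ehom_ccomp.
rewrite [X in _ = ccomp _ X]ehom_tmap.
exact (trunc_proj_kappa (Cw_pure_homology hX) (Cw_pure_homology hY) (Cw_pure_homology hXY)).
Qed.

Transparent tmap tcplx.

Lemma trunc_proj_endo_eta (h1 : Cw_ob iota w unit_ob) :
  trunc_proj_endo h1 \oc Defs.eta (trunc_smfunctor iota w)
  = Defs.eta (endo_smfunctor (homology k)).
Proof.
apply: endo_hom_eq; rewrite [LHS]ehom_ccomp.
exact (trunc_proj_eta (Cw_pure_homology h1)).
Qed.

End ProjectionMonoidal.

Theorem theorem5p2p1 (k : fieldType) (char0 : [pchar k] =i pred0)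
    (K : closedFieldType) (iota : {rmorphism k -> K})
    (algK : forall x : K, algebraicOver iota x) (w : weight K) :
  exists (cl : monoidal_closed (Cw_ob iota w))
         (stable : forall X : endo_smcat (cplx_smcat k),
            Cw_ob iota w X ->
            Cw_ob iota w (endo_smfunctor (homology k) X)),
    formal (@homology_iso k K iota w cl) (Cw_homology cl stable).
Proof.
exists (Cw_closed iota w), (@Cw_stable k K iota w).
pose T := full_smfunctor (Cw_closed iota w) (@Cw_trunc k K iota w).
apply: (@rst_trans _ _ _ T).
(* The inclusion points from T to the identity functor, so this edge of the zigzag is traversed
   backwards. *)
- apply/rst_sym/rst_step.
  exists (full_smtrans_id (Cw_closed iota w) (@Cw_trunc k K iota w) (trunc_inc_smtrans iota w)).
  move=> X; have [_ fX _] := svalP X.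
  exact: (trunc_incl_quasi_iso (Cw_pure_homology (svalP X)) fX).
- apply/rst_step.
  exists (full_smtrans (Cw_closed iota w) (@Cw_trunc k K iota w) (@Cw_stable k K iota w)
    (@trunc_proj_endo_nat k K iota w) (@trunc_proj_endo_kappa k K iota w)
    (@trunc_proj_endo_eta k K iota w)).
  move=> X; have [_ fX _] := svalP X.
  exact: (trunc_proj_quasi_iso (Cw_pure_homology (svalP X)) fX).
Qed.
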